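(* Let $E$ be an MLUR Köthe function space over a complete $\sigma$-finite measure space and let $X$ be a Banach space. If $X$ is mluacs, then so is $E(X)$. If $X$ is msluacs and in addition $E^*$ has the Kadets-Klee* property and $B_{E^*}$ is weak*-sequentially compact, then $E(X)$ is also msluacs.
   Context: All Banach spaces are real. For a Banach space $X$, $X^*$ denotes its dual, $B_X$ its closed unit ball and $S_X$ its unit sphere. A Banach space $X$ is called: - MLUR (midpoint locally uniformly rotund) if for any two sequences $(x_n)$, $(y_n)$ in $S_X$ and every $x\in S_X$: $\|x-\frac{x_n+y_n}{2}\|\to0$ implies $\|x_n-y_n\|\to0$; - mluacs (midpoint locally uniformly alternatively convex or smooth) if for any two sequences $(x_n)$, $(y_n)$ in $S_X$, every $x\in S_X$ and every $x^*\in S_{X^*}$: $\|x-\frac{x_n+y_n}{2}\|\to0$ and $x^*(x_n)\to1$ imply $x^*(y_n)\to1$; - msluacs (midpoint strongly locally uniformly alternatively convex or smooth) if for any two sequences $(x_n)$, $(y_n)$ in $S_X$, every $x\in S_X$ and every sequence $(x_n^* )$ in $S_{X^*}$: $\|x-\frac{x_n+y_n}{2}\|\to0$ and $x_n^*(x_n)\to1$ imply $x_n^*(y_n)\to1$. A dual space $X^*$ has the Kadets-Klee* property if for every sequence $(x_n^* )$ in $X^*$ and each $x^*\in X^*$: $x_n^*\to x^*$ weak* and $\|x_n^*\|\to\|x^*\|$ imply $\|x_n^*-x^*\|\to0$. A Köthe function space over a complete, $\sigma$-finite measure space $(S,\mathcal{A},\mu)$ is a Banach space $(E,\|\cdot\|_E)$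 of real-valued measurable functions on $S$ modulo equality $\mu$-a.e. such that: (i) $\chi_A\in E$ for every $A\in\mathcal{A}$ with $\mu(A)<\infty$; (ii) every $f\in E$ is $\mu$-integrable over every $A\in\mathcal{A}$ with $\mu(A)<\infty$; (iii) if $g$ is measurable and $f\in E$ with $|g(t)|\le|f(t)|$ $\mu$-a.e., then $g\in E$ and $\|g\|_E\le\|f\|_E$. For a Köthe function space $E$ and a Banach space $X$, the Köthe-Bochner space $E(X)$ is the Banach space of all Bochner-measurable functions $f:S\to X$ (modulo equality a.e.) with $\|f(\cdot)\|\in E$, normed by $\|f\|_{E(X)}=\|\,\|f(\cdot)\|\,\|_E$; Bochner-measurable means being the $\mu$-a.e. norm limit of a sequence of simple functions. *)

(* Defs.v *)
From HB Require Import structures.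
From mathcomp Require Import all_boot all_order all_algebra.
From mathcomp Require Import all_classical all_reals all_analysis.
From mathcomp Require Import measurable_realfun.

Set Implicit Arguments.
Unset Strict Implicit.
Unset Printing Implicit Defensive.

Import Order.TTheory GRing.Theory Num.Theory.
Import numFieldNormedType.Exports.

Local Open Scope classical_set_scope.
Local Open Scope ring_scope.

Section dual.
Context {R : realType} (V : normedModType R).

Definition unit_sphere : set V := [set x | `|x| = 1].

Definition unit_ball : set V := [set x | `|x| <= 1].

Definition dual : set (V -> R) := [set f : V -> R | scalar f /\ continuous f].

Definition dual_norm (f : V -> R) : R := sup [set `|f x| | x in unit_ball].

Definition dual_sphere : set (V -> R) := [set f | dual f /\ dual_norm f = 1].

Definition dual_ball : set (V -> R) := [set f | dual f /\ dual_norm f <= 1].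

Definition weak_star_cvg (f_ : (V -> R)^nat) (f : V -> R) : Prop :=
  forall x : V, f_ n x @[n --> \oo] --> f x.

End dual.

Arguments unit_sphere {R} V.
Arguments unit_ball {R} V.
Arguments dual {R} V.
Arguments dual_sphere {R} V.
Arguments dual_ball {R} V.

Section rotundity.
Context {R : realType} (V : normedModType R).

Definition MLUR : Prop := forall (x_ y_ : V^nat) (x : V),
  (forall n, unit_sphere V (x_ n)) -> (forall n, unit_sphere V (y_ n)) ->
  unit_sphere V x ->
  `|x - 2^-1 *: (x_ n + y_ n)| @[n --> \oo] --> (0 : R) ->
  `|x_ n - y_ n| @[n --> \oo] --> (0 : R).

Definition mluacs : Prop := forall (x_ y_ : V^nat) (x : V) (f : V -> R),
  (forall n, unit_sphere V (x_ n)) -> (forall n, unit_sphere V (y_ n)) ->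
  unit_sphere V x -> dual_sphere V f ->
  `|x - 2^-1 *: (x_ n + y_ n)| @[n --> \oo] --> (0 : R) ->
  f (x_ n) @[n --> \oo] --> (1 : R) ->
  f (y_ n) @[n --> \oo] --> (1 : R).

Definition msluacs : Prop :=
  forall (x_ y_ : V^nat) (x : V) (f_ : (V -> R)^nat),
  (forall n, unit_sphere V (x_ n)) -> (forall n, unit_sphere V (y_ n)) ->
  unit_sphere V x -> (forall n, dual_sphere V (f_ n)) ->
  `|x - 2^-1 *: (x_ n + y_ n)| @[n --> \oo] --> (0 : R) ->
  f_ n (x_ n) @[n --> \oo] --> (1 : R) ->
  f_ n (y_ n) @[n --> \oo] --> (1 : R).

Definition dual_kadets_klee_star : Prop :=
  forall (f_ : (V -> R)^nat) (f : V -> R),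
  (forall n, dual V (f_ n)) -> dual V f ->
  weak_star_cvg f_ f ->
  dual_norm (f_ n) @[n --> \oo] --> dual_norm f ->
  dual_norm (f_ n \- f) @[n --> \oo] --> (0 : R).

Definition dual_ball_weak_star_seq_compact : Prop :=
  forall f_ : (V -> R)^nat, (forall n, dual_ball V (f_ n)) ->
  exists phi : nat -> nat, exists f : V -> R,
    [/\ {homo phi : m n / (m < n)%N}, dual_ball V f &
        weak_star_cvg (f_ \o phi) f].

End rotundity.

Arguments MLUR {R} V.
Arguments mluacs {R} V.
Arguments msluacs {R} V.
Arguments dual_kadets_klee_star {R} V.
Arguments dual_ball_weak_star_seq_compact {R} V.

(* The points of a Koethe function space are classes of functions modulo a.e.
   equality; koethe_fun picks a representative of each class, hence it is linear
   only up to null sets. *)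
Record koetheSpace {R : realType} d {T : measurableType d}
    (mu : {measure set T -> \bar R}) := KoetheSpace {
  koethe_sort :> completeNormedModType R ;
  koethe_fun : koethe_sort -> T -> R ;
  measurable_koethe_fun : forall f, measurable_fun [set: T] (koethe_fun f) ;
  koethe_fun_linear : forall (a : R) (f g : koethe_sort),
    koethe_fun (a *: f + g) =
    (fun t => a * koethe_fun f t + koethe_fun g t) %[ae mu] ;
  koethe_fun_inj : forall f g : koethe_sort,
    koethe_fun f = koethe_fun g %[ae mu] -> f = g ;
  koethe_indic : forall A : set T, measurable A -> (mu A < +oo)%E ->
    exists f : koethe_sort, koethe_fun f = (\1_A : T -> R) %[ae mu] ;
  koethe_integrable : forall (f : koethe_sort) (A : set T),
    measurable A -> (mu A < +oo)%E ->
    mu.-integrable A (EFin \o koethe_fun f) ;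
  koethe_ideal : forall (f : koethe_sort) (g : T -> R),
    measurable_fun [set: T] g ->
    (\forall t \ae mu, `|g t| <= `|koethe_fun f t|) ->
    exists2 h : koethe_sort,
      koethe_fun h = g %[ae mu] & `|h| <= `|f|
}.

Section koethe_norm.
Context {R : realType} d {T : measurableType d}.
Context {mu : {measure set T -> \bar R}} (E : koetheSpace mu).
Implicit Types g : T -> R.

Definition in_koethe g : Prop := exists e : E, koethe_fun e = g %[ae mu].

(* 0 when the class of g is not in E *)
Definition koethe_norm g : R :=
  `|xget (0 : E) [set e : E | koethe_fun e = g %[ae mu]]|.

Lemma koethe_normE g (e : E) :
  koethe_fun e = g %[ae mu] -> koethe_norm g = `|e|.
Proof.
move=> eg; rewrite /koethe_norm; case: xgetP => [f _ fg|/(_ e)]; last first.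
  by move=> /(_ eg).
congr (`|_|); apply: koethe_fun_inj; apply: filterS2 fg eg.
by move=> t /= + + _ => /(_ I) -> /(_ I) ->.
Qed.

Lemma koethe_fun0 : koethe_fun (0 : E) = cst 0 %[ae mu].
Proof.
have := @koethe_fun_linear _ _ _ _ E (-1) 0 0.
apply: filterS => t /(_ I).
by rewrite scaler0 addr0 mulN1r addNr => ->.
Qed.

Lemma koethe_funD (e f : E) :
  koethe_fun (e + f) = (fun t => koethe_fun e t + koethe_fun f t) %[ae mu].
Proof.
have := @koethe_fun_linear _ _ _ _ E 1 e f.
by apply: filterS => t /(_ I); rewrite scale1r mul1r => ->.
Qed.

Lemma koethe_funZ a (e : E) :
  koethe_fun (a *: e) = (fun t => a * koethe_fun e t) %[ae mu].
Proof.
have := @koethe_fun_linear _ _ _ _ E a e 0.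
apply: filterS2 koethe_fun0 => t /= /(_ I) -> /(_ I).
by rewrite !addr0.
Qed.

Lemma koethe_abs (e : E) : exists2 h : E,
  koethe_fun h = (fun t => `|koethe_fun e t|) %[ae mu] & `|h| = `|e|.
Proof.
have me := measurable_koethe_fun e.
have mabs : measurable_fun [set: T] (fun t => `|koethe_fun e t|).
  exact: measurableT_comp.
have [|h he hle] := @koethe_ideal _ _ _ _ E e _ mabs.
  by apply: aeW => t /=; rewrite normr_id.
exists h => //; apply/eqP; rewrite eq_le hle /=.
have [|e' e'e e'le] := @koethe_ideal _ _ _ _ E h _ me.
  by apply: filterS he => t /= /(_ I) ->; rewrite normr_id.
by rewrite -(koethe_fun_inj e'e).
Qed.

End koethe_norm.

Section bochner.
Context {R : realType} d {T : measurableType d}.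
Implicit Types X Y : normedModType R.

(* {sfun T >-> R} only covers real-valued simple functions. *)
Definition simple_fun X (s : T -> X) : Prop :=
  finite_set (range s) /\ forall x, measurable (s @^-1` [set x]).

Definition bochner_measurable (mu : {measure set T -> \bar R}) X
    (f : T -> X) : Prop :=
  exists2 s : (T -> X)^nat, (forall n, simple_fun (s n)) &
    \forall t \ae mu, s n t @[n --> \oo] --> f t.

Lemma simple_fun_cst X (x : X) : simple_fun (cst x : T -> X).
Proof.
split; first by apply: sub_finite_set (finite_set1 x) => _ [t _ <-].
move=> y; have [->|xy] := eqVneq x y.
  by rewrite (_ : _ @^-1` _ = setT) //; apply/seteqP; split.
rewrite (_ : _ @^-1` _ = set0)//; apply/seteqP; split => // t /= xyE.
by rewrite xyE eqxx in xy.
Qed.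

Lemma simple_fun_comp2 X Y Z (h : X -> Y -> Z) (s : T -> X) (r : T -> Y) :
  simple_fun s -> simple_fun r ->
  finite_set (range (fun t => h (s t) (r t))) /\
  forall B, measurable ((fun t => h (s t) (r t)) @^-1` B).
Proof.
move=> [fs ms] [fr mr]; split.
  apply: sub_finite_set (finite_image2 h fs fr) => _ [t _ <-].
  by exists (s t); [exists t|exists (r t) => //; exists t].
move=> B; pose D := (range s `*` range r) `&` [set p | B (h p.1 p.2)].
rewrite (_ : _ @^-1` B =
    \bigcup_(p in D) (s @^-1` [set p.1] `&` r @^-1` [set p.2])).
  apply: fin_bigcup_measurable => [|p _]; last exact: measurableI.
  exact/finite_setIl/finite_setX.
apply/seteqP; split => [t /= Bt|t [[x y] [_ /= Bxy] [/= -> ->]]] //.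
by exists (s t, r t) => //; split => //=; split; exists t.
Qed.

Lemma simple_funD X (s r : T -> X) :
  simple_fun s -> simple_fun r -> simple_fun (s \+ r).
Proof.
by move=> ss sr; have [? m] := simple_fun_comp2 (fun x y => x + y) ss sr.
Qed.

Lemma simple_funZ X a (s : T -> X) : simple_fun s -> simple_fun (a \*: s).
Proof.
by move=> ss; have [? m] := simple_fun_comp2 (fun x _ => a *: x) ss ss.
Qed.

Lemma measurable_norm_simple_fun X (s : T -> X) :
  simple_fun s -> measurable_fun [set: T] (fun t => `|s t|).
Proof.
move=> ss _ B mB; rewrite setTI.
by have [_] := simple_fun_comp2 (fun x _ => `|x|) ss ss; exact.
Qed.

Variable mu : {measure set T -> \bar R}.

Lemma bochner_measurable_cst X (x : X) : bochner_measurable mu (cst x).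
Proof.
exists (fun=> cst x) => [n|]; first exact: simple_fun_cst.
by apply: aeW => t; exact: cvg_cst.
Qed.

Lemma bochner_measurableD X (f g : T -> X) : bochner_measurable mu f ->
  bochner_measurable mu g -> bochner_measurable mu (f \+ g).
Proof.
move=> [s ss sf] [r sr rg]; exists (fun n => s n \+ r n) => [n|].
  exact: simple_funD.
by apply: filterS2 sf rg => t sf rg; exact: cvgD.
Qed.

Lemma bochner_measurableZ X a (f : T -> X) : bochner_measurable mu f ->
  bochner_measurable mu (a \*: f).
Proof.
move=> [s ss sf]; exists (fun n => a \*: s n) => [n|]; first exact: simple_funZ.
by apply: filterS sf => t sf; exact: cvgZr.
Qed.

Lemma bochner_measurable_norm X (f : T -> X) : bochner_measurable mu f ->
  exists2 g : T -> R, measurable_fun [set: T] g &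
    g = (fun t => `|f t|) %[ae mu].
Proof.
move=> [s ss [N [mN N0 sN]]]; exists (fun t => `|f t| * \1_(~` N) t).
  apply: (@measurable_fun_cvg _ _ _ _ (fun n t => `|s n t| * \1_(~` N) t)).
    move=> n; apply: measurable_funM; first exact: measurable_norm_simple_fun.
    by apply: measurable_indic; exact: measurableC.
  move=> t _; rewrite indicE; have [tN|tN] := boolP (t \in ~` N).
    under eq_fun do rewrite mulr1.
    rewrite mulr1; apply: cvg_norm; apply: contrapT => nf.
    by move: tN; rewrite inE => -[]; apply: sN.
  under eq_fun do rewrite mulr0.
  by rewrite mulr0; exact: cvg_cst.
exists N; split => // t /= h; apply: contrapT => Nt; apply: h => _.
by rewrite indicE mem_set ?mulr1.
Qed.

End bochner.

Section koethe_bochner_fun.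
Context {R : realType} d {T : measurableType d}.
Context {mu : {measure set T -> \bar R}}.
Variables (E : koetheSpace mu) (X : normedModType R).

(* "The function |f(.)| belongs to E" means that its class does: |f(.)| itself
   need only be a.e. equal to a measurable function, see
   bochner_measurable_norm. *)
Definition koethe_bochner_pred : {pred T -> X} :=
  mem [set f : T -> X | bochner_measurable mu f /\
                        in_koethe E (fun t => `|f t|)].

Lemma koethe_norm_le (f : T -> X) (e : E) : bochner_measurable mu f ->
  (\forall t \ae mu, `|f t| <= `|koethe_fun e t|) ->
  exists2 h : E, koethe_fun h = (fun t => `|f t|) %[ae mu] & `|h| <= `|e|.
Proof.
move=> /bochner_measurable_norm [g mg gf] fe.
have [|h hg hle] := @koethe_ideal _ _ _ _ E e _ mg.
  by apply: filterS2 gf fe => t /= /(_ I) ->; rewrite normr_id.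
exists h => //; apply: filterS2 hg gf => t /= /(_ I) -> /(_ I) ->.
by [].
Qed.

Lemma koethe_norm_triangle (f g : T -> X) (e e' : E) :
  bochner_measurable mu f -> bochner_measurable mu g ->
  koethe_fun e = (fun t => `|f t|) %[ae mu] ->
  koethe_fun e' = (fun t => `|g t|) %[ae mu] ->
  exists2 h : E, koethe_fun h = (fun t => `|f t + g t|) %[ae mu] &
    `|h| <= `|e| + `|e'|.
Proof.
move=> mf mg ef eg; have [|h hfg hle] :=
    @koethe_norm_le (f \+ g) (e + e') (bochner_measurableD mf mg).
  apply: filterS3 ef eg (koethe_funD e e') => t /= /(_ I) ef /(_ I) eg /(_ I).
  by rewrite ef eg => ->; rewrite ger0_norm ?addr_ge0// ler_normD.
by exists h => //; exact: le_trans (ler_normD _ _).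
Qed.

Lemma koethe_norm_scale (f : T -> X) (e : E) (a : R) :
  koethe_fun e = (fun t => `|f t|) %[ae mu] ->
  koethe_fun (`|a| *: e) = (fun t => `|a *: f t|) %[ae mu].
Proof.
move=> ef; apply: filterS2 ef (koethe_funZ `|a| e) => t /= /(_ I) -> /(_ I) ->.
by rewrite normrZ.
Qed.

Lemma koethe_bochner_submod_closed : submod_closed koethe_bochner_pred.
Proof.
split.
  rewrite inE; split; first exact: bochner_measurable_cst.
  exists 0; apply: filterS (koethe_fun0 E) => t /= /(_ I) -> _.
  by rewrite normr0.
move=> a f g; rewrite !inE => -[mf [e ef]] [mg [e' eg]]; split.
  by apply: bochner_measurableD => //; exact: bochner_measurableZ.
have [h ? _] := koethe_norm_triangle (bochner_measurableZ a mf) mg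
  (koethe_norm_scale a ef) eg.
by exists h.
Qed.

HB.instance Definition _ :=
  GRing.isSubmodClosed.Build R (T -> X) koethe_bochner_pred
    koethe_bochner_submod_closed.

Record koetheBochnerFun := KoetheBochnerFun {
  koethe_bochner_val :> T -> X ;
  koethe_bochnerP : koethe_bochner_val \in koethe_bochner_pred
}.

HB.instance Definition _ := [isSub for koethe_bochner_val].
HB.instance Definition _ := [Choice of koetheBochnerFun by <:].
HB.instance Definition _ := [SubChoice_isSubLmodule of koetheBochnerFun by <:].

End koethe_bochner_fun.

Section koethe_bochner.
Context {R : realType} d {T : measurableType d}.
Context {mu : {measure set T -> \bar R}}.
Variables (E : koetheSpace mu) (X : normedModType R).

Local Open Scope quotient_scope.

Definition koethe_bochner_eq (f g : koetheBochnerFun E X) : bool :=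
  `[< f = g %[ae mu] >].

Let koethe_bochner_eq_refl : reflexive koethe_bochner_eq.
Proof. by move=> f; apply/asboolP; exact: ae_eq_refl. Qed.

Let koethe_bochner_eq_sym : symmetric koethe_bochner_eq.
Proof. by move=> f g; apply/asboolP/asboolP; exact: ae_eq_sym. Qed.

Let koethe_bochner_eq_trans : transitive koethe_bochner_eq.
Proof.
by move=> f g h /asboolP gf /asboolP fh; apply/asboolP/(ae_eq_trans gf fh).
Qed.

Canonical koethe_bochner_equiv :=
  EquivRel koethe_bochner_eq koethe_bochner_eq_refl koethe_bochner_eq_sym
    koethe_bochner_eq_trans.

Definition koetheBochner : Type := {eq_quot koethe_bochner_eq}.

HB.instance Definition _ := Choice.on koetheBochner.
HB.instance Definition _ := EqQuotient.on koetheBochner.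

Local Notation cls := (\pi_koetheBochner).

Implicit Types (f g : koetheBochnerFun E X) (x y z : koetheBochner).

Lemma koethe_bochner_surj x : exists f, x = cls f.
Proof. by exists (repr x); rewrite reprK. Qed.

Lemma koethe_bochner_eqP f g :
  cls f = cls g <-> f = g %[ae mu].
Proof.
split=> [/eqP|fg]; first by rewrite eqmodE => /asboolP.
by apply/eqP; rewrite eqmodE; apply/asboolP.
Qed.

Lemma koethe_bochner_reprK f : repr (cls f) = f %[ae mu].
Proof. by apply/koethe_bochner_eqP; rewrite reprK. Qed.

Definition koethe_bochner_add x y := cls (repr x + repr y).
Definition koethe_bochner_opp x := cls (- repr x).
Definition koethe_bochner_scale (a : R) x := cls (a *: repr x).
Definition koethe_bochner_norm x := koethe_norm E (fun t => `|repr x t|).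

Let piD f g : koethe_bochner_add (cls f) (cls g) = cls (f + g).
Proof.
apply/koethe_bochner_eqP.
apply: filterS2 (koethe_bochner_reprK f) (koethe_bochner_reprK g).
by move=> t /= /(_ I) ft /(_ I) gt _; rewrite /= !fctE ft gt.
Qed.

Let piN f : koethe_bochner_opp (cls f) = cls (- f).
Proof.
apply/koethe_bochner_eqP; apply: filterS (koethe_bochner_reprK f).
by move=> t /= /(_ I) ft _; rewrite /= !fctE ft.
Qed.

Let piZ a f : koethe_bochner_scale a (cls f) = cls (a *: f).
Proof.
apply/koethe_bochner_eqP; apply: filterS (koethe_bochner_reprK f).
by move=> t /= /(_ I) ft _; rewrite /= !fctE ft.
Qed.

Let addA : associative koethe_bochner_add.
Proof.
move=> x y z; have [f ->] := koethe_bochner_surj x.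
have [g ->] := koethe_bochner_surj y; have [h ->] := koethe_bochner_surj z.
by rewrite !piD addrA.
Qed.

Let addC : commutative koethe_bochner_add.
Proof.
move=> x y; have [f ->] := koethe_bochner_surj x.
by have [g ->] := koethe_bochner_surj y; rewrite !piD addrC.
Qed.

Let add0 : left_id (cls 0) koethe_bochner_add.
Proof.
by move=> x; have [f ->] := koethe_bochner_surj x; rewrite piD add0r.
Qed.

Let addN : left_inverse (cls 0) koethe_bochner_opp koethe_bochner_add.
Proof.
by move=> x; have [f ->] := koethe_bochner_surj x; rewrite piN piD addNr.
Qed.

HB.instance Definition _ :=
  GRing.isZmodule.Build koetheBochner addA addC add0 addN.

Let scaleA a b x : koethe_bochner_scale a (koethe_bochner_scale b x) =
  koethe_bochner_scale (a * b) x.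
Proof. by have [f ->] := koethe_bochner_surj x; rewrite !piZ scalerA. Qed.

Let scale1 : left_id 1 koethe_bochner_scale.
Proof.
by move=> x; have [f ->] := koethe_bochner_surj x; rewrite piZ scale1r.
Qed.

Let scaleDr : right_distributive koethe_bochner_scale koethe_bochner_add.
Proof.
move=> a x y; have [f ->] := koethe_bochner_surj x.
have [g ->] := koethe_bochner_surj y.
by rewrite piD !piZ scalerDr -piD.
Qed.

Let scaleDl x :
  {morph koethe_bochner_scale^~ x : a b / a + b >-> koethe_bochner_add a b}.
Proof.
by have [f ->] := koethe_bochner_surj x => a b; rewrite !piZ scalerDl -piD.
Qed.

HB.instance Definition _ := GRing.Zmodule_isLmodule.Build R koetheBochner
  scaleA scale1 scaleDr scaleDl.

Lemma koethe_bochner_piD f g : cls f + cls g = cls (f + g).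
Proof. exact: piD. Qed.

Lemma koethe_bochner_piN f : - cls f = cls (- f).
Proof. exact: piN. Qed.

Lemma koethe_bochner_piZ a f : a *: cls f = cls (a *: f).
Proof. exact: piZ. Qed.

Lemma koethe_bochner_fun_measurable f : bochner_measurable mu f.
Proof. by have := koethe_bochnerP f; rewrite inE => -[]. Qed.

Lemma koethe_bochner_fun_norm f :
  exists e : E, koethe_fun e = (fun t => `|f t|) %[ae mu].
Proof. by have := koethe_bochnerP f; rewrite inE => -[]. Qed.

Lemma koethe_bochner_normE f (e : E) :
  koethe_fun e = (fun t => `|f t|) %[ae mu] ->
  koethe_bochner_norm (cls f) = `|e|.
Proof.
move=> ef; apply: koethe_normE; apply: filterS2 ef (koethe_bochner_reprK f).
by move=> t /= /(_ I) -> /(_ I) ->.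
Qed.

Let normD x y :
  koethe_bochner_norm (x + y) <= koethe_bochner_norm x + koethe_bochner_norm y.
Proof.
have [f ->] := koethe_bochner_surj x; have [g ->] := koethe_bochner_surj y.
rewrite koethe_bochner_piD.
have [e ef] := koethe_bochner_fun_norm f.
have [e' eg] := koethe_bochner_fun_norm g.
have [h hfg] := koethe_norm_triangle (koethe_bochner_fun_measurable f)
  (koethe_bochner_fun_measurable g) ef eg.
by rewrite (koethe_bochner_normE ef) (koethe_bochner_normE eg)
  (@koethe_bochner_normE (f + g) h).
Qed.

Let normZ a x : koethe_bochner_norm (a *: x) = `|a| * koethe_bochner_norm x.
Proof.
have [f ->] := koethe_bochner_surj x; rewrite koethe_bochner_piZ.
have [e ef] := koethe_bochner_fun_norm f.
rewrite (koethe_bochner_normE ef).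
by rewrite (@koethe_bochner_normE (a *: f) _ (koethe_norm_scale a ef)) normrZ
  normr_id.
Qed.

Let norm0_eq0 x : koethe_bochner_norm x = 0 -> x = 0.
Proof.
have [f ->] := koethe_bochner_surj x; have [e ef] := koethe_bochner_fun_norm f.
rewrite (koethe_bochner_normE ef) => /normr0_eq0 e0.
apply/koethe_bochner_eqP; move: ef; rewrite e0 => ef.
apply: filterS2 ef (koethe_fun0 E) => t /= /(_ I) -> /(_ I) /normr0_eq0 + _.
by [].
Qed.

HB.instance Definition _ := Lmodule_isNormed.Build R koetheBochner
  normD normZ norm0_eq0.

Lemma koethe_bochner_normrE x : `|x| = koethe_norm E (fun t => `|repr x t|).
Proof. by []. Qed.

End koethe_bochner.

(* Main.v *)
Require Import Defs.
From HB Require Import structures.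
From mathcomp Require Import all_boot all_order all_algebra.
From mathcomp Require Import all_classical all_reals all_analysis.
From mathcomp Require Import measurable_realfun lra ring.

Set Implicit Arguments.
Unset Strict Implicit.
Unset Printing Implicit Defensive.

Import Order.TTheory GRing.Theory Num.Theory.
Import numFieldNormedType.Exports.

Local Open Scope classical_set_scope.
Local Open Scope ring_scope.

(** The theorem is true because a functional F on the Koethe-Bochner space
    splits into functionals on X indexed by the points t of the measure space,
    and because the midpoint condition passes to almost every t; the condition
    on X is then applied at each t, and the result is integrated.

    Let x_n and y_n be unit vectors whose midpoints tend to a unit vector x.
    The scalar functions |x_n(.)| and |y_n(.)| have norm one in E, and
    |x(.)| is at most their mean up to an error that tends to zero.  In an
    MLUR lattice a positive perturbation that does not increase the norm in the
    limit tends to zero ([MLUR_koethe_monotone]), since reversing its sign does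
    not increase the norm either.  This forces both sequences to
    converge to |x(.)| in E ([MLUR_koethe_average]).

    The same monotonicity makes E order continuous
    ([MLUR_order_continuous]).  Hence A |-> F(1_A z) is a finite signed measure
    that is absolutely continuous with respect to mu, and has a
    Radon-Nikodym density phi_z.  The pointwise functionals only have to be
    defined on the countably many values x_n(t), y_n(t).  The least weight
    rho with |phi_z(t)| <= rho(t) |z(t)| for all integer combinations z of the
    x_n and y_n satisfies int rho |e| <= |e| for every e in E
    ([admissible_sup]), so that the Hahn-Banach theorem at the point t provides
    G_t on X with |G_t| <= rho(t) and G_t(z(t)) = phi_z(t)
    ([functional_disintegration]).

    Assume F_n(x_n) -> 1.  Then rho_n |x_n| - G_n(x_n) >= 0 has integral
    tending to zero, so that it tends to zero almost everywhere along a
    subsequence.  If moreover rho_n |x(.)| converges in L1, the limit vanishes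
    at t, in which case G_{n,t}(y_n(t)) tends to zero with its bound, or it is
    positive, in which case the hypothesis on X applies to the normalized
    vectors and functionals at t ([weighted_alternative]).  In both cases
    rho_n |y_n| - G_n(y_n) tends to zero at t, and dominated convergence gives
    F_n(y_n) -> 1 ([convergence_along_subseq]).

    For mluacs the functional, hence the weight, does not depend on n, and the
    L1 convergence is trivial.  For msluacs the weights act on E as
    functionals in the unit ball of the dual that are almost norming at the
    norm-one element |x(.)|.  A weak* cluster point attains its norm there, so
    that the Kadets-Klee* property turns weak* convergence into norm
    convergence, and norm convergence of the weights implies their L1
    convergence against |x(.)| ([weights_cauchy]). *)

(** * Hahn-Banach extension from a convex cone of constraints *)

Section hahn_banach.
Context {R : realType} (V : lmodType R).
Implicit Types (p q : V -> R) (K : set (V * R)).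

Definition sublinear p :=
  (forall x y, p (x + y) <= p x + p y) /\
  (forall (a : R) x, 0 < a -> p (a *: x) <= a * p x).

Definition convex_cone K :=
  [/\ K (0, 0), forall u v, K u -> K v -> K (u + v) &
      forall (a : R) u, 0 < a -> K u -> K (a *: u.1, a * u.2)].

Lemma sublinear0 p : sublinear p -> p 0 = 0.
Proof.
move=> [pD pZ]; have := pD 0 0; have := pZ 2^-1 0 ltac:(by lra).
rewrite scaler0 addr0; lra.
Qed.

Lemma sublinearN_ge p x : sublinear p -> - p (- x) <= p x.
Proof.
move=> sp; have := sp.1 x (- x); rewrite subrr sublinear0 //; lra.
Qed.

(** For [K] spanned by [(y, p y)] this lowers [p] as much as linearity along [y]
    would require; for [K] the graph of a functional dominated by [p], the
    linear minorants of the result are the dominated extensions. *)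
Definition cone_inf p K x := inf [set p (x + u.1) - u.2 | u in K].

Section cone_inf.
Variables (p : V -> R) (K : set (V * R)).
Hypotheses (sp : sublinear p) (cK : convex_cone K).
Hypothesis pK : forall u, K u -> u.2 <= p u.1.

Let cone_inf_lb x : lbound [set p (x + u.1) - u.2 | u in K] (- p (- x)).
Proof.
move=> _ [u Ku <-]; have := pK Ku; have := sp.1 (- x) (x + u.1).
rewrite addKr; lra.
Qed.

Let cone_inf_hlb x : has_lbound [set p (x + u.1) - u.2 | u in K].
Proof. by exists (- p (- x)); exact: cone_inf_lb. Qed.

Let cone_inf_neq0 x : [set p (x + u.1) - u.2 | u in K] !=set0.
Proof. by case: cK => K0 _ _; exists (p (x + 0) - 0), (0, 0). Qed.

Lemma cone_inf_le x u : K u -> cone_inf p K x <= p (x + u.1) - u.2.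
Proof. by move=> Ku; apply: ge_inf => //; exists u. Qed.

Let le_cone_inf x b : (forall u, K u -> b <= p (x + u.1) - u.2) ->
  b <= cone_inf p K x.
Proof. by move=> bK; apply: lb_le_inf => // _ [u Ku <-]; exact: bK. Qed.

Lemma cone_inf_le0 x : cone_inf p K x <= p x.
Proof.
by case: cK => K0 _ _; have := cone_inf_le x K0; rewrite /= addr0 subr0.
Qed.

Lemma sublinear_cone_inf : sublinear (cone_inf p K).
Proof.
case: cK => K0 KD KZ; split => [x y|a x a0].
  rewrite -lerBlDr; apply: le_cone_inf => u Ku.
  rewrite lerBlDr -lerBlDl; apply: le_cone_inf => v Kv.
  have := cone_inf_le (x + y) (KD _ _ Ku Kv).
  have := sp.1 (x + u.1) (y + v.1); rewrite /= (addrACA x).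
  lra.
rewrite -ler_pdivrMl//; apply: le_cone_inf => u Ku.
rewrite ler_pdivrMl//; have := cone_inf_le (a *: x) (KZ a _ a0 Ku).
have := sp.2 a (x + u.1) a0; rewrite /= scalerDr mulrBr; lra.
Qed.

End cone_inf.

(** Zorn's lemma applies because the members [q] of a chain below [p] have the
    common lower bound [q x >= - q (- x) >= - p (- x)], so that their pointwise
    infimum is again sublinear. *)
Lemma sublinear_minimal p : sublinear p -> exists f, [/\ sublinear f,
  forall x, f x <= p x &
  forall q, sublinear q -> (forall x, q x <= f x) -> q = f].
Proof.
move=> sp; pose S := {q : V -> R | sublinear q /\ forall x, q x <= p x}.
pose le (q r : S) := `[< forall x, sval r x <= sval q x >].
have p' : S by exists p.
have [| | |A totA|[f [sf fp]] fmin] := @Zorn S le.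
- by move=> q; apply/asboolP.
- move=> q r s /asboolP qr /asboolP rs; apply/asboolP => x.
  exact: le_trans (rs x) (qr x).
- move=> [q Pq] [r Pr] /asboolP /= qr /asboolP /= rq.
  by apply: eq_exist; apply/funext => x; apply/eqP; rewrite eq_le qr rq.
- have [->|/set0P[q0 Aq0]] := eqVneq A set0; first by exists p'.
  pose m x := inf [set sval q x | q in A].
  have Ax0 x : [set sval q x | q in A] !=set0 by exists (sval q0 x), q0.
  have hlb x : has_lbound [set sval q x | q in A].
    exists (- p (- x)) => _ [[q [sq qp]] _ <-] /=.
    by apply: le_trans (sublinearN_ge x sq); rewrite lerN2.
  have mle (q : S) x : A q -> m x <= sval q x.
    by move=> Aq; apply: ge_inf => //; exists q.
  have mP : sublinear m /\ forall x, m x <= p x.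
    split; last by move=> x; apply: le_trans (mle _ _ Aq0) ((svalP q0).2 x).
    split => [x y|a x a0].
      rewrite -lerBlDr; apply: lb_le_inf => // _ [q Aq <-].
      rewrite lerBlDr -lerBlDl; apply: lb_le_inf => // _ [r Ar <-].
      rewrite lerBlDl; have [/asboolP h|/asboolP h] := totA _ _ Aq Ar.
        have := mle _ (x + y) Ar; have := (svalP r).1.1 x y.
        by have := h x; lra.
      have := mle _ (x + y) Aq; have := (svalP q).1.1 x y.
      by have := h y; lra.
    rewrite -ler_pdivrMl//; apply: lb_le_inf => // _ [q Aq <-].
    rewrite ler_pdivrMl//; apply: le_trans (mle _ _ Aq) _.
    exact: (svalP q).1.2.
  exists (exist _ m mP) => q Aq; apply/asboolP => x /=; exact: mle.
exists f; split=> // q sq qf.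
have qP : sublinear q /\ forall x, q x <= p x.
  by split => // x; apply: le_trans (qf x) (fp x).
suff /(congr1 sval) : exist _ q qP = exist _ f (conj sf fp) :> S by [].
by apply: fmin; apply/asboolP.
Qed.

(** A minimal sublinear [f] is linear: lowering it along [y] by [cone_inf] gives
    a sublinear functional below [f], hence [f] itself, and this equality says
    that [f x + f y <= f (x + y)]. *)
Lemma sublinear_ge_scalar p : sublinear p ->
  exists2 f : V -> R, scalar f & forall x, f x <= p x.
Proof.
move=> /sublinear_minimal[f [sf fp fmin]]; exists f => //.
have fD x y : f (x + y) = f x + f y.
  apply/eqP; rewrite eq_le sf.1/=.
  pose K : set (V * R) := [set u | exists2 a : R, 0 <= a & u = (a *: y,
    a * f y)].
  have cK : convex_cone K; first split.
  - by exists 0; rewrite ?lexx// scale0r mul0r.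
  - move=> _ _ [a a0 ->] [b b0 ->]; exists (a + b); first exact: addr_ge0.
    by rewrite scalerDl mulrDl.
  - move=> a _ a0 [b b0 ->]; exists (a * b); first exact/mulr_ge0/b0/ltW.
    by rewrite /= scalerA mulrA.
  have fK u : K u -> u.2 <= f u.1.
    move=> [a a0 ->] /=; move: a0; rewrite le_eqVlt => /predU1P[<-|a0].
      by rewrite mul0r scale0r sublinear0.
    rewrite -ler_pdivlMl//; apply: le_trans (sf.2 _ _ _);
      last by rewrite invr_gt0.
    by rewrite scalerA mulVf ?scale1r// gt_eqF.
  have <- := fmin _ (sublinear_cone_inf sf cK fK) (cone_inf_le0 sf cK fK).
  have : K (y, f y) by exists 1; rewrite // scale1r mul1r.
  move=> /(cone_inf_le sf fK x) /=.
  rewrite (fmin _ (sublinear_cone_inf sf cK fK) (cone_inf_le0 sf cK fK)); lra.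
have f0 : f 0 = 0 by exact: sublinear0.
have fN x : f (- x) = - f x.
  by apply/eqP; rewrite -addr_eq0 -fD addNr f0.
have fZ a x : 0 < a -> f (a *: x) = a * f x.
  move=> a0; apply/eqP; rewrite eq_le sf.2//= -ler_pdivlMl//.
  apply: le_trans (sf.2 _ _ _); last by rewrite invr_gt0.
  by rewrite scalerA mulVf ?scale1r// gt_eqF.
move=> a x y; rewrite fD; congr (_ + _).
have [a0|a0|->] := ltgtP a 0; last by rewrite scale0r mul0r.
  by rewrite -[RHS]opprK -mulNr -fZ ?oppr_gt0// scaleNr fN opprK.
exact: fZ.
Qed.

End hahn_banach.

(** [K] stands for the graph of the functional to be extended; that it is
    single-valued is a consequence of the bound. *)
Lemma hahn_banach_cone {R : realType} (V : normedModType R) (K : set (V * R))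
    (c : R) : 0 <= c -> convex_cone K -> (forall u, K u -> u.2 <= c * `|u.1|) ->
  exists f : V -> R, [/\ scalar f, forall x, `|f x| <= c * `|x| &
    forall u, K u -> K (- u) -> f u.1 = u.2].
Proof.
move=> c0 cK Kc; pose p (x : V) := c * `|x|.
have sp : sublinear p.
  split => [x y|a x a0]; first by rewrite /p -mulrDr ler_wpM2l// ler_normD.
  by rewrite /p normrZ gtr0_norm// mulrCA.
have [f lf fle] := sublinear_ge_scalar (sublinear_cone_inf sp cK Kc).
have fN x : f (- x) = - f x.
  have f0 : f 0 = 0.
    by have := lf 1 0 0; rewrite scale1r mul1r addr0; lra.
  by have := lf (-1) x 0; rewrite scaleN1r !addr0 mulN1r f0 addr0.
have fp x : f x <= p x by apply: le_trans (fle x) (cone_inf_le0 sp cK Kc x).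
have fge u : K u -> u.2 <= f u.1.
  move=> Ku; have := cone_inf_le sp Kc (- u.1) Ku; have := fle (- u.1).
  rewrite fN addNr /p normr0 mulr0; lra.
exists f; split => // [x|u Ku KNu].
  by rewrite ler_norml fp andbT -lerN2 opprK -fN -normrN fp.
by have := fge _ Ku; have := fge _ KNu; rewrite /= fN; lra.
Qed.

(** * Subsequences and dual norms *)

Section sequences.
Context {R : realType}.
Implicit Types (u v : R^nat) (phi : nat -> nat).

Lemma cvg_dist_le (V : normedModType R) (u : V^nat) (v : R^nat) (l : V) :
  (\forall n \near \oo, `|u n - l| <= v n) -> v n @[n --> \oo] --> (0 : R) ->
  u n @[n --> \oo] --> l.
Proof.
move=> uv v0; apply/cvgrPdistC_le => e e0.
move/cvgrPdistC_le : v0 => /(_ _ e0); apply: filterS2 uv => n uv.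
by rewrite subr0 => /(le_trans (ler_norm _)); exact: le_trans.
Qed.

Lemma cvg_normB (V : normedModType R) (u : V^nat) (l : V) :
  `|u n - l| @[n --> \oo] --> (0 : R) -> u n @[n --> \oo] --> l.
Proof. by apply: cvg_dist_le; exact: nearW. Qed.

Lemma normB_cvg (V : normedModType R) (u : V^nat) (l : V) :
  u n @[n --> \oo] --> l -> `|u n - l| @[n --> \oo] --> (0 : R).
Proof.
move=> ul; rewrite -(normr0 V) -(subrr l); apply: cvg_norm.
by apply: cvgB => //; exact: cvg_cst.
Qed.

Lemma homo_geidn phi : {homo phi : m n / (m < n)%N} -> forall n, (n <= phi n)%N.
Proof.
by move=> hphi; elim=> // n ih; apply: leq_ltn_trans ih _; exact: hphi.
Qed.

Lemma homo_cvg_nat phi : {homo phi : m n / (m < n)%N} ->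
  phi n @[n --> \oo] --> \oo.
Proof.
move=> hphi A [N _ NA]; exists N => // n /= Nn; apply: NA => /=.
exact: leq_trans Nn (homo_geidn hphi n).
Qed.

Lemma cvg_subseq (V : normedModType R) (u : V^nat) (l : V) phi :
  {homo phi : m n / (m < n)%N} ->
  u n @[n --> \oo] --> l -> u (phi n) @[n --> \oo] --> l.
Proof. by move=> /homo_cvg_nat hphi ul; exact: cvg_comp hphi ul. Qed.

(** The common source of fast subsequences, where [P k] is a bound by a
    geometric term, and of subsequences that stay away from a limit. *)
Lemma frequently_subseq (P : nat -> nat -> Prop) :
  (forall k N, exists2 n, (N <= n)%N & P k n) ->
  exists2 phi, {homo phi : m n / (m < n)%N} & forall k, P k (phi k).
Proof.
move=> /(_ _ _)/cid2 h; pose phi := fix phi k :=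
  if k is k'.+1 then s2val (h (phi k').+1 k) else s2val (h 0%N 0%N).
exists phi.
  apply: homo_ltn => [y x z|k]; first exact: ltn_trans.
  exact: (s2valP (h (phi k).+1 k.+1)).
case=> [|k]; first exact: (s2valP' (h 0%N 0%N)).
exact: (s2valP' (h (phi k).+1 k.+1)).
Qed.

Lemma cvg_sub_subseq u (l : R) :
  (forall phi, {homo phi : m n / (m < n)%N} -> exists2 psi,
     {homo psi : m n / (m < n)%N} & u (phi (psi n)) @[n --> \oo] --> l) ->
  u n @[n --> \oo] --> l.
Proof.
move=> h; apply: contrapT => /cvgrPdist_lt /existsNP[e /not_implyP[e0 eN]].
have [_ N|phi hphi ephi] := @frequently_subseq (fun _ n => e <= `|l - u n|).
  apply: contrapT => hN; apply: eN; exists N => // n /= Nn.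
  by rewrite ltNge; apply/negP => le; apply: hN; exists n.
have [psi hpsi /cvgrPdist_lt/(_ _ e0)[N _ /(_ N (leqnn N))/=]] := h phi hphi.
by apply/negP; rewrite -leNgt.
Qed.

End sequences.

Section dual_norm_theory.
Context {R : realType} {V : normedModType R}.
Implicit Types (f : V -> R) (x : V).

Lemma scalar0 f : scalar f -> f 0 = 0.
Proof. by move=> lf; have := lf 1 0 0; rewrite scale1r mul1r addr0; lra. Qed.

Lemma scalarD f : scalar f -> forall x y, f (x + y) = f x + f y.
Proof. by move=> lf x y; have := lf 1 x y; rewrite scale1r mul1r. Qed.

Lemma scalarZ f : scalar f -> forall a x, f (a *: x) = a * f x.
Proof. by move=> lf a x; have := lf a x 0; rewrite !addr0 scalar0// addr0. Qed.

Lemma scalarN f : scalar f -> forall x, f (- x) = - f x.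
Proof. by move=> lf x; rewrite -scaleN1r scalarZ// mulN1r. Qed.

Lemma scalarB f : scalar f -> forall x y, f (x - y) = f x - f y.
Proof. by move=> lf x y; rewrite scalarD// scalarN. Qed.

Lemma scalar_bounded_dual f (c : R) : scalar f -> (forall x,
  `|f x| <= c * `|x|) ->
  dual V f.
Proof.
move=> lf fc; split => // x; apply/cvgrPdistC_le => e e0.
have d0 : 0 < e / (`|c| + 1) by rewrite divr_gt0// ltr_wpDl.
near=> y; rewrite -scalarB//; apply: le_trans (fc _) _.
have : `|y - x| <= e / (`|c| + 1).
  near: y; have : (fun y : V => y) @ x --> x by exact: cvg_id.
  by move=> /cvgrPdistC_le; exact.
rewrite ler_pdivlMr ?ltr_wpDl// => h; apply: le_trans _ h.
rewrite mulrC ler_wpM2l//; have := ler_norm c; lra.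
Unshelve. all: by end_near. Qed.

Let unit_ball0 f : [set `|f x| | x in unit_ball V] `|f 0|.
Proof. by exists 0 => //; rewrite /unit_ball /= normr0. Qed.

Lemma dual_norm_bounded f c : 0 <= c -> (forall x, `|f x| <= c * `|x|) ->
  dual_norm f <= c.
Proof.
move=> c0 fc; apply: ge_sup; first by exists `|f 0|; exact: unit_ball0.
by move=> _ [x x1 <-]; apply: le_trans (fc x) _; rewrite ler_piMr.
Qed.

Lemma dual_has_ubound f : dual V f ->
  has_ubound [set `|f x| | x in unit_ball V].
Proof.
move=> [lf /(_ 0)/cvgrPdistC_lt/(_ 1 ltr01)].
rewrite near_simpl => /nbhs_ballP[e /= e0 he].
exists (2 / e) => _ [x x1 <-].
have : ball (0 : V) e ((e / 2) *: x).
  rewrite -ball_normE /= sub0r normrN normrZ gtr0_norm ?divr_gt0//.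
  by apply: (@le_lt_trans _ _ (e / 2)); [rewrite ler_piMr// divr_ge0// ltW|lra].
move=> /he /=; rewrite (scalar0 lf) subr0 (scalarZ lf) normrM gtr0_norm
  ?divr_gt0//.
by rewrite -ltr_pdivlMl ?divr_gt0// mulr1 invf_div => /ltW.
Qed.

Lemma dual_norm_ge0 f : dual V f -> 0 <= dual_norm f.
Proof.
move=> df; apply: le_trans (normr_ge0 (f 0)) _; apply: ub_le_sup => //.
exact: dual_has_ubound.
Qed.

Lemma dual_norm_le f x : dual V f -> `|f x| <= dual_norm f * `|x|.
Proof.
move=> df; have [->|x0] := eqVneq x 0.
  by rewrite (scalar0 (proj1 df)) !normr0 mulr0.
rewrite -ler_pdivrMr ?normr_gt0//.
have -> : `|f x| / `|x| = `|f (`|x|^-1 *: x)|.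
  by rewrite (scalarZ (proj1 df)) normrM normfV normr_id mulrC.
apply: ub_le_sup; first exact: dual_has_ubound.
exists (`|x|^-1 *: x) => //; rewrite /unit_ball /= normrZ normfV normr_id.
by rewrite mulVf// normr_eq0.
Qed.

End dual_norm_theory.

(** * Scale-free forms of the rotundity conditions *)

Section normalization.
Context {R : realType} {V : normedModType R}.

Lemma addr_double (x : V) : x + x = 2 *: x.
Proof. by rewrite scaler_nat mulr2n. Qed.

(** The definitions of the rotundity conditions only speak of unit vectors; this
    replaces an almost normalized vector by a unit one at the cost
    [`|1 - `|v| |], the case [v = 0] included. *)
Lemma unit_near (x0 v : V) : `|x0| = 1 ->
  exists2 u : V, `|u| = 1 & `|u - v| = `|1 - `|v| |.
Proof.
move=> x01; have [->|v0] := eqVneq v 0.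
  by exists x0 => //; rewrite normr0 !subr0 x01 normr1.
exists (`|v|^-1 *: v); first by rewrite normrZ normfV normr_id mulVf ?normr_eq0.
rewrite -[X in _ - X]scale1r -scalerBl normrZ -[X in _ * X]normr_id -normrM.
by rewrite mulrBl mul1r mulVf// normr_eq0.
Qed.

Lemma unit_seq_near (x0 : V) (v : V^nat) : `|x0| = 1 ->
  exists u : V^nat, (forall n, `|u n| = 1) /\
    forall n, `|u n - v n| = `|1 - `|v n| |.
Proof.
move=> /unit_near h; have /choice[u hu] : forall n, exists u : V, `|u| = 1 /\
    `|u - v n| = `|1 - `|v n| | by move=> n; have [u u1 u2] := h (v n);
      exists u.
by exists u; split => n; have [] := hu n.
Qed.

End normalization.

Section MLUR_theory.
Context {R : realType} {V : normedModType R}.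
Hypothesis V_MLUR : MLUR V.

(** [x] is the midpoint of [x + h n] and [x - h n], whose difference is
    [2 *: h n]. *)
Lemma MLUR_pm_unit (x : V) (h : V^nat) : `|x| = 1 ->
  `|x + h n| @[n --> \oo] --> (1 : R) -> `|x - h n| @[n --> \oo] --> (1 : R) ->
  `|h n| @[n --> \oo] --> (0 : R).
Proof.
move=> x1 hp hm.
have [u [u1 uE]] := unit_seq_near (fun n => x + h n) x1.
have [v [v1 vE]] := unit_seq_near (fun n => x - h n) x1.
have up : `|u n - (x + h n)| @[n --> \oo] --> (0 : R).
  under eq_fun do rewrite uE distrC; exact: normB_cvg.
have vm : `|v n - (x - h n)| @[n --> \oo] --> (0 : R).
  under eq_fun do rewrite vE distrC; exact: normB_cvg.
have uv : `|u n - v n| @[n --> \oo] --> (0 : R).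
  apply: (V_MLUR u1 v1 x1).
  apply: (@cvg_dist_le _ _ _
      (fun n => `|u n - (x + h n)| + `|v n - (x - h n)|)); last first.
    by rewrite -[0 in X in _ --> X]addr0; apply: cvgD.
  apply: nearW => n; rewrite subr0 normr_id.
  have -> : x - 2^-1 *: (u n + v n) =
      - (2^-1 *: ((u n - (x + h n)) + (v n - (x - h n)))).
    rewrite addrACA -opprD [(x + h n) + _]addrACA subrr addr0 scalerBr opprB.
    by rewrite addr_double scalerA mulVf ?scale1r.
  rewrite normrN normrZ gtr0_norm; last by lra.
  have := ler_normD (u n - (x + h n)) (v n - (x - h n)).
  have := normr_ge0 ((u n - (x + h n)) + (v n - (x - h n))).
  by lra.
apply: (@cvg_dist_le _ _ _ (fun n =>
  `|u n - (x + h n)| + `|v n - (x - h n)| + `|u n - v n|)); last first.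
  rewrite -[0 in X in _ --> X]addr0; apply: cvgD => //.
  by rewrite -[0 in X in _ --> X]addr0; apply: cvgD.
apply: nearW => n; rewrite subr0 normr_id.
have hE : h n *+ 2 = (v n - (x - h n)) - (u n - (x + h n)) + (u n - v n).
  rewrite (opprB (u n)) -addrA subrKA addrC subrKA opprB addrC subrKA.
  by rewrite mulr2n.
have : `|h n *+ 2| = 2 * `|h n|.
  by rewrite mulr2n addr_double normrZ ger0_norm.
have := ler_normB (v n - (x - h n)) (u n - (x + h n)).
have := ler_normD ((v n - (x - h n)) - (u n - (x + h n))) (u n - v n).
rewrite -hE; have := normr_ge0 (h n); lra.
Qed.

(** Upper bounds on both norms suffice, since [x] being the midpoint forces
    [2 * `|x| <= `|x + h n| + `|x - h n|]. *)
Lemma MLUR_pm (x : V) (h : V^nat) (e : R^nat) :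
  (forall n, `|x + h n| <= `|x| + e n) -> (forall n,
    `|x - h n| <= `|x| + e n) ->
  e n @[n --> \oo] --> (0 : R) -> `|h n| @[n --> \oo] --> (0 : R).
Proof.
move=> hp hm e0; have [x0|x0] := eqVneq x 0.
  apply: (@cvg_dist_le _ _ _ e) => //; apply: nearW => n.
  by have := hp n; rewrite x0 normr0 !add0r subr0 normr_id.
have nx : 0 < `|x| by rewrite normr_gt0.
have pm n : 2 * `|x| <= `|x + h n| + `|x - h n|.
  apply: le_trans (ler_normD _ _); rewrite addrACA subrr addr0 addr_double.
  by rewrite normrZ ger0_norm.
suff hx : `| `|x|^-1 *: h n| @[n --> \oo] --> (0 : R).
  have -> : (fun n => `|h n|) = (fun n => `|x| * `| `|x|^-1 *: h n|).
    by apply/funext => n;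
      rewrite normrZ normfV normr_id mulrA divff ?mul1r// gt_eqF.
  by rewrite -(mulr0 `|x|); apply: cvgM => //; exact: cvg_cst.
have ex0 : `|x|^-1 * e n @[n --> \oo] --> (0 : R).
  by rewrite -(mulr0 `|x|^-1); apply: cvgM => //; exact: cvg_cst.
apply: (@MLUR_pm_unit (`|x|^-1 *: x)).
- by rewrite normrZ normfV normr_id mulVf// gt_eqF.
- apply: cvg_dist_le ex0; apply: nearW => n.
  rewrite -scalerDr normrZ normfV normr_id -(mulVf (lt0r_neq0 nx)) -mulrBr.
  rewrite normrM normfV normr_id ler_wpM2l ?invr_ge0// ler_norml.
  by have := hp n; have := hm n; have := pm n; lra.
- apply: cvg_dist_le ex0; apply: nearW => n.
  rewrite -scalerBr normrZ normfV normr_id -(mulVf (lt0r_neq0 nx)) -mulrBr.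
  rewrite normrM normfV normr_id ler_wpM2l ?invr_ge0// ler_norml.
  by have := hp n; have := hm n; have := pm n; lra.
Qed.

End MLUR_theory.

Section alternative.
Context {R : realType} (V : normedModType R).
Implicit Types (C : set ((V -> R)^nat)).

(** The common form of [mluacs], where the functionals are constant in [n], and
    of [msluacs], where they are arbitrary: both cases of the theorem then have
    one proof. *)
Definition midpoint_alternative C : Prop :=
  forall (x_ y_ : V^nat) (x : V) (f_ : (V -> R)^nat),
  (forall n, unit_sphere V (x_ n)) -> (forall n, unit_sphere V (y_ n)) ->
  unit_sphere V x -> (forall n, dual_sphere V (f_ n)) -> C f_ ->
  `|x - 2^-1 *: (x_ n + y_ n)| @[n --> \oo] --> (0 : R) ->
  f_ n (x_ n) @[n --> \oo] --> (1 : R) ->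
  f_ n (y_ n) @[n --> \oo] --> (1 : R).

Definition constant_seq : set ((V -> R)^nat) := [set f_ | forall n,
  f_ n = f_ 0%N].

(** What allows functionals to be normalized without leaving [C]. *)
Definition termwise_stable C :=
  forall (s : (V -> R) -> V -> R) f_, C f_ -> C (fun n => s (f_ n)).

Definition subseq_stable C :=
  forall (phi : nat -> nat) f_, C f_ -> C (fun n => f_ (phi n)).

Lemma mluacs_alternative : mluacs V -> midpoint_alternative constant_seq.
Proof.
move=> VP x_ y_ x f_ x1 y1 x01 f1 fE mid fx.
have fE' : f_ = fun=> f_ 0%N by apply/funext.
by rewrite fE'; apply: (VP x_ y_ x) => //; rewrite fE' in fx.
Qed.

Lemma msluacs_alternative : msluacs V -> midpoint_alternative setT.
Proof. by move=> VP x_ y_ x f_ x1 y1 x01 f1 _; exact: VP. Qed.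

(** The vectors are divided by [`|x|] and the functionals by their norms, which
    tend to [r]: they are at most [r_ n], and at least
    [f_ n (x_ n) / `|x_ n|]. *)
Lemma alternative_scaled C (x_ y_ : V^nat) (x : V) (f_ : (V -> R)^nat)
    (r_ : R^nat) (r : R) :
  termwise_stable C -> midpoint_alternative C -> C f_ ->
  (forall n, scalar (f_ n)) -> (forall n z, `|f_ n z| <= r_ n * `|z|) ->
  r_ n @[n --> \oo] --> r -> 0 < r -> x != 0 ->
  `|x_ n| @[n --> \oo] --> `|x| -> `|y_ n| @[n --> \oo] --> `|x| ->
  `|x - 2^-1 *: (x_ n + y_ n)| @[n --> \oo] --> (0 : R) ->
  f_ n (x_ n) @[n --> \oo] --> r * `|x| ->
  f_ n (y_ n) @[n --> \oo] --> r * `|x|.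
Proof.
move=> sC altC Cf lf fr rr r0 x0 xx yx mid fx.
pose c := `|x|; have c0 : 0 < c by rewrite normr_gt0.
have df n : dual V (f_ n) := scalar_bounded_dual (lf n) (fr n).
have u1 : `|c^-1 *: x| = 1 by rewrite normrZ normfV normr_id mulVf// gt_eqF.
have scale_cvg (z : V^nat) : `|z n| @[n --> \oo] --> c ->
    `|c^-1 *: z n| @[n --> \oo] --> (1 : R).
  move=> zc; have -> : (fun n => `|c^-1 *: z n|) = (fun n => c^-1 * `|z n|).
    by apply/funext => n; rewrite normrZ normfV normr_id.
  by rewrite -(mulVf (lt0r_neq0 c0)); apply: cvgM => //; exact: cvg_cst.
have [u [u_1 uE]] := unit_seq_near (fun n => c^-1 *: x_ n) u1.
have [v [v_1 vE]] := unit_seq_near (fun n => c^-1 *: y_ n) u1.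
have ux : `|u n - c^-1 *: x_ n| @[n --> \oo] --> (0 : R).
  under eq_fun do rewrite uE distrC; exact/normB_cvg/scale_cvg.
have vy : `|v n - c^-1 *: y_ n| @[n --> \oo] --> (0 : R).
  under eq_fun do rewrite vE distrC; exact/normB_cvg/scale_cvg.
pose N n := dual_norm (f_ n).
have N0 n : 0 <= N n by exact: dual_norm_ge0.
have Nr n : N n <= r_ n.
  have r_0 : 0 <= r_ n.
    have := fr n x; rewrite -ler_pdivrMr//; apply: le_trans.
    by rewrite divr_ge0// ltW.
  exact: dual_norm_bounded.
have NN : N n @[n --> \oo] --> r.
  have fxx : f_ n (x_ n) / `|x_ n| @[n --> \oo] --> r.
    rewrite -(mulfK (lt0r_neq0 c0) r); apply: cvgM => //.
    by apply: cvgV => //; rewrite gt_eqF.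
  apply: (squeeze_cvgr _ fxx rr); near=> n; rewrite Nr andbT.
  have xn0 : 0 < `|x_ n| by near: n; exact: (cvgr_gt _ xx).
  rewrite ler_pdivrMr//; apply: le_trans (dual_norm_le _ (df n)).
  exact: ler_norm.
(* The functionals of norm zero, finitely many at most, have to be replaced by
   some unit functional; a normalized f_ n0 serves. *)
have [n0 Nn0] : exists n, N n != 0.
  have : \forall n \near \oo, 0 < N n by exact: (cvgr_gt _ NN).
  by move=> [n _ /(_ n (leqnn n)) h]; exists n; rewrite gt_eqF.
pose normalize (g : V -> R) : V -> R :=
  if `[< dual V g /\ dual_norm g != 0 >] then fun z => (dual_norm g)^-1 * g z
  else fun z => (N n0)^-1 * f_ n0 z.
have norm1 (g : V -> R) : dual V g -> dual_norm g != 0 ->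
    dual_sphere V (fun z => (dual_norm g)^-1 * g z).
  move=> dg g0; have gp : 0 < dual_norm g by rewrite lt_neqAle eq_sym g0
    dual_norm_ge0.
  have lg : scalar (fun z => (dual_norm g)^-1 * g z).
    by move=> a z w; rewrite dg.1 mulrDr mulrCA.
  have gle z : `|(dual_norm g)^-1 * g z| <= 1 * `|z|.
    rewrite normrM normfV (gtr0_norm gp) mul1r ler_pdivrMl//.
    exact: dual_norm_le.
  have dg' := scalar_bounded_dual lg gle.
  split => //; apply/eqP; rewrite eq_le dual_norm_bounded//=.
  rewrite -(ler_pM2l gp) mulr1; apply: dual_norm_bounded => [|z].
    by rewrite mulr_ge0// dual_norm_ge0.
  rewrite -mulrA -ler_pdivrMl//; apply: le_trans (dual_norm_le z dg').
  by rewrite normrM normfV (gtr0_norm gp).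
have fn1 n : dual_sphere V (normalize (f_ n)).
  by rewrite /normalize; case: asboolP => [[? ?]|_]; exact: norm1.
have nE : \forall n \near \oo, normalize (f_ n) = fun z => (N n)^-1 * f_ n z.
  near=> n; rewrite /normalize asboolT//; split => //.
  by rewrite gt_eqF//; near: n; exact: (cvgr_gt _ NN).
have NV : (N n)^-1 @[n --> \oo] --> r^-1 by apply: cvgV => //; rewrite gt_eqF.
have fcvg (z w : V^nat) : (fun n => `|w n - c^-1 *: z n|) @ \oo --> (0 : R) ->
    (fun n => normalize (f_ n) (w n) - (N n)^-1 * (c^-1 * f_ n (z n))) @ \oo -->
    (0 : R).
  move=> wz; apply: cvg_dist_le wz; near=> n.
  have -> : normalize (f_ n) = fun z => (N n)^-1 * f_ n z by near: n.
  have Nn : 0 < N n by near: n; exact: (cvgr_gt _ NN).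
  rewrite subr0 -mulrBr -(scalarZ (lf n)) -scalarB// normrM normfV.
  by rewrite (gtr0_norm Nn) ler_pdivrMl//; exact: dual_norm_le.
have nu1 : normalize (f_ n) (u n) @[n --> \oo] --> (1 : R).
  have : (N n)^-1 * (c^-1 * f_ n (x_ n)) @[n --> \oo] --> r^-1 * (c^-1 * (r *
    c)).
    by apply: cvgM => //; apply: cvgM => //; exact: cvg_cst.
  have -> : r^-1 * (c^-1 * (r * c)) = 1.
    by field; rewrite !gt_eqF.
  move=> /(cvgD (fcvg _ _ ux)); rewrite add0r; apply: cvg_trans.
  by apply: near_eq_cvg; apply: nearW => n /=; rewrite subrK.
have nv1 : normalize (f_ n) (v n) @[n --> \oo] --> (1 : R).
  apply: (altC u v (c^-1 *: x) (fun n => normalize (f_ n))) => //.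
    exact: sC.
  apply: (@cvg_dist_le _ _ _ (fun n => `|u n - c^-1 *: x_ n| +
      `|v n - c^-1 *: y_ n| + c^-1 * `|x - 2^-1 *: (x_ n + y_ n)|)).
    apply: nearW => n; rewrite subr0 normr_id.
    have -> : c^-1 *: x - 2^-1 *: (u n + v n) =
      c^-1 *: (x - 2^-1 *: (x_ n + y_ n))
        - 2^-1 *: ((u n - c^-1 *: x_ n) + (v n - c^-1 *: y_ n)).
      rewrite [X in _ = _ - _ *: X]addrACA -opprD -scalerDr !scalerBr opprB.
      by rewrite !scalerA (mulrC 2^-1) subrKA.
    apply: le_trans (ler_normB _ _) _.
    rewrite !normrZ !normfV normr_id (@gtr0_norm _ 2)//.
    have := ler_normD (u n - c^-1 *: x_ n) (v n - c^-1 *: y_ n).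
    have := normr_ge0 (u n - c^-1 *: x_ n);
      have := normr_ge0 (v n - c^-1 *: y_ n).
    rewrite -/c; lra.
  rewrite -[0 in X in _ --> X]addr0; apply: cvgD => //.
    by rewrite -[0 in X in _ --> X]addr0; apply: cvgD.
  by rewrite -(mulr0 c^-1); apply: cvgM => //; exact: cvg_cst.
have h : (N n * c) * (normalize (f_ n) (v n) -
    (normalize (f_ n) (v n) - (N n)^-1 * (c^-1 * f_ n (y_ n)))) @[n --> \oo] -->
    (r * c) * (1 - 0).
  apply: cvgM; first by apply: cvgM => //; exact: cvg_cst.
  by apply: cvgB => //; exact: fcvg.
rewrite subr0 mulr1 in h; apply: cvg_trans h; apply: near_eq_cvg.
near=> n; have Nn : 0 < N n by near: n; exact: (cvgr_gt _ NN).
rewrite /= subKr; by field; rewrite !gt_eqF.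
Unshelve. all: by end_near. Qed.

End alternative.

(** * The lattice operations of a Koethe space *)

Section right_continuity_point.
Context {R : realType}.

(** A monotone function has only countably many discontinuities, hence not all
    points of an interval are discontinuities. *)
Lemma nondecreasing_right_continuity_point (f : R -> R) (c : R) :
  {homo f : x y / x <= y} -> (forall x, 0 <= f x <= c) ->
  exists r, forall e, 0 < e -> exists2 s, r < s & f s <= f r + e.
Proof.
move=> ndf fc; have [r [r01 ndr]] : exists r, (r \in `]0,
  1[%R) /\ ~ discontinuity f r.
  apply: contrapT => /forallNP h.
  have : countable [set x | x \in `]0, 1[%R /\ discontinuity f x].
    by apply: discontinuity_countable => x y _ _; exact: ndf.
  rewrite (_ : [set _ | _] = `]0, 1[%classic).
    move=> /countable_lebesgue_measure0.
    by rewrite lebesgue_measure_itv /= lte_fin ltr01 -EFinB subr0 => -[]/eqP;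
      rewrite oner_eq0.
  apply/seteqP; split => [x []|x x01] //; split => //.
  by apply: contrapT => dx; apply: (h x).
have fcl : cvg (f x @[x --> r^'-]).
  apply: nondecreasing_at_left_is_cvgr.
    by apply: nearW => x a b _ _; exact: ndf.
  by apply: nearW => x; exists c => _ [y _ <-]; have /andP[] := fc y.
have fcr : cvg (f x @[x --> r^'+]).
  apply: nondecreasing_at_right_is_cvgr.
    by apply: nearW => x a b _ _; exact: ndf.
  by apply: nearW => x; exists 0 => _ [y _ <-]; have /andP[] := fc y.
have lr : lim (f x @[x --> r^'-]) = lim (f x @[x --> r^'+]).
  by apply: contrapT => /eqP lr; apply: ndr.
have ll : lim (f x @[x --> r^'-]) <= f r.
  apply: limr_le => //; near=> x; apply: ndf; apply/ltW; near: x.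
  exact: nbhs_left_lt.
exists r => e e0.
have : \forall x \near r^'+, f x < f r + e.
  by apply: cvgr_lt fcr _ _; rewrite -lr (le_lt_trans ll)// ltrDl.
move=> h; have [x [rx fx]] : exists x, r < x /\ f x < f r + e.
  near r^'+ => x; exists x; split; near: x => //; exact: nbhs_right_gt.
by exists x => //; exact: ltW.
Unshelve. all: by end_near. Qed.

End right_continuity_point.

Section koethe_lattice.
Context {R : realType} d {T : measurableType d}.
Context {mu : {measure set T -> \bar R}} (E : koetheSpace mu).
Implicit Types (e f : E) (A B : set T).

Local Notation kfun := (@koethe_fun R d T mu E).

Lemma ae_eqT U (f g : T -> U) :
  (f = g %[ae mu]) = (\forall t \ae mu, f t = g t).
Proof.
by apply/propext; split; apply: filterS => t h //; apply: h.
Qed.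

Lemma koethe_funDE e f :
  \forall t \ae mu, kfun (e + f) t = kfun e t + kfun f t.
Proof. by have := koethe_funD e f; rewrite ae_eqT. Qed.

Lemma koethe_funZE (a : R) e :
  \forall t \ae mu, kfun (a *: e) t = a * kfun e t.
Proof. by have := koethe_funZ a e; rewrite ae_eqT. Qed.

Lemma koethe_funNE e :
  \forall t \ae mu, kfun (- e) t = - kfun e t.
Proof. by rewrite -scaleN1r; apply: filterS (koethe_funZE (-1) e) => t ->;
  rewrite mulN1r. Qed.

Lemma koethe_funBE e f :
  \forall t \ae mu, kfun (e - f) t = kfun e t - kfun f t.
Proof. by apply: filterS2 (koethe_funDE e (- f)) (koethe_funNE f) => t ->
  ->. Qed.

(** The ideal property provides some class with the values of [e] and small
    norm; it is the class of [e] since classes are determined by their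
    values. *)
Lemma koethe_le e f :
  (\forall t \ae mu, `|kfun e t| <= `|kfun f t|) -> `|e| <= `|f|.
Proof.
move=> ef; have [h he] := koethe_ideal (measurable_koethe_fun e) ef.
by rewrite (koethe_fun_inj he).
Qed.

Lemma koethe_dominated e (g : T -> R) : measurable_fun [set: T] g ->
  (\forall t \ae mu, `|g t| <= `|kfun e t|) ->
  exists f, \forall t \ae mu, kfun f t = g t.
Proof.
by move=> mg ge; have [h + _] := koethe_ideal mg ge; rewrite ae_eqT; exists h.
Qed.

Lemma koethe_norm_abs e :
  exists2 f, `|f| = `|e| & \forall t \ae mu, kfun f t = `|kfun e t|.
Proof. by have [f + ?] := koethe_abs e; rewrite ae_eqT; exists f. Qed.

Lemma koethe_pospart e :
  exists f, \forall t \ae mu, kfun f t = Num.max (kfun e t) 0.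
Proof.
apply: (@koethe_dominated e).
  by apply: measurable_maxr => //; exact: measurable_koethe_fun.
apply: aeW => t /=; rewrite ger0_norm; last by rewrite le_max lexx orbT.
by rewrite ge_max ler_norm normr_ge0.
Qed.

Definition koethe_restr A e : E :=
  xget 0 [set f | \forall t \ae mu, kfun f t = \1_A t * kfun e t].

Lemma normr_indicM A (t : T) (x : R) : `|\1_A t * x| <= `|x|.
Proof.
rewrite indicE; case: (_ \in _); first by rewrite mul1r.
by rewrite mul0r normr0.
Qed.

Lemma koethe_restrE A e : measurable A ->
  \forall t \ae mu, kfun (koethe_restr A e) t = \1_A t * kfun e t.
Proof.
move=> mA; rewrite /koethe_restr; case: xgetP => [f -> //|h].
have [||f /h//] := @koethe_dominated e (fun t => \1_A t * kfun e t).
  by apply: measurable_funM;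
    [exact: measurable_indic|exact: measurable_koethe_fun].
by apply: aeW => t; exact: normr_indicM.
Qed.

Lemma koethe_restrB A e f : measurable A ->
  koethe_restr A (e - f) = koethe_restr A e - koethe_restr A f.
Proof.
move=> mA; apply: koethe_fun_inj; rewrite ae_eqT; near=> t.
have -> : kfun (koethe_restr A (e - f)) t = \1_A t * kfun (e - f) t.
  by near: t; exact: koethe_restrE.
have -> : kfun (koethe_restr A e - koethe_restr A f) t =
    kfun (koethe_restr A e) t - kfun (koethe_restr A f) t.
  by near: t; exact: koethe_funBE.
have -> : kfun (koethe_restr A e) t = \1_A t * kfun e t.
  by near: t; exact: koethe_restrE.
have -> : kfun (koethe_restr A f) t = \1_A t * kfun f t.
  by near: t; exact: koethe_restrE.
rewrite -mulrBr; congr (_ * _); near: t; exact: koethe_funBE.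
Unshelve. all: by end_near. Qed.

Lemma koethe_restr_le A e : measurable A -> `|koethe_restr A e| <= `|e|.
Proof.
move=> mA; apply: koethe_le; apply: filterS (koethe_restrE e mA) => t ->.
exact: normr_indicM.
Qed.

Lemma koethe_restrS A B e : measurable A -> measurable B -> A `<=` B ->
  `|koethe_restr A e| <= `|koethe_restr B e|.
Proof.
move=> mA mB AB; apply: koethe_le.
apply: filterS2 (koethe_restrE e mA) (koethe_restrE e mB) => t -> ->.
rewrite !normrM ler_wpM2r// !indicE ger0_norm ?ler0n// ger0_norm ?ler0n//
  ler_nat.
by have [tA|//] := boolP (t \in A); rewrite mem_set//; exact/AB/set_mem.
Qed.

Lemma koethe_restrD A e B : measurable A -> measurable B ->
  [disjoint A & B]%classic ->
  koethe_restr (A `|` B) e = koethe_restr A e + koethe_restr B e.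
Proof.
move=> mA mB /disj_setPLR AB; apply: koethe_fun_inj; rewrite ae_eqT.
apply: filterS2 (filterI (koethe_restrE e mA) (koethe_restrE e mB))
  (filterI (koethe_restrE e (measurableU _ _ mA mB))
    (koethe_funDE (koethe_restr A e) (koethe_restr B e))).
move=> t [h1 h2] [-> ->]; rewrite h1 h2 -mulrDl; congr (_ * _).
rewrite !indicE in_setU; have [/set_mem/AB tB|_] := boolP (t \in A).
  by rewrite memNset ?addr0.
by rewrite add0r.
Qed.

End koethe_lattice.

(** * Midpoint local uniform rotundity and the order of a Koethe space *)

Section MLUR_koethe.
Context {R : realType} d {T : measurableType d}.
Context {mu : {measure set T -> \bar R}} (E : koetheSpace mu).
Hypothesis E_MLUR : MLUR E.

Local Notation kfun := (@koethe_fun R d T mu E).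
Implicit Types (a e : E) (h : E^nat).

(** For nonnegative [a] and [h n] one has [`|a - h n| <= a + h n] pointwise, so
    that the norm of [a - h n] is controlled as well and [MLUR_pm] applies. *)
Lemma MLUR_koethe_monotone a h (c : R^nat) :
  (\forall t \ae mu, 0 <= kfun a t) ->
  (forall n, \forall t \ae mu, 0 <= kfun (h n) t) ->
  (forall n, `|a + h n| <= `|a| + c n) -> c n @[n --> \oo] --> (0 : R) ->
  `|h n| @[n --> \oo] --> (0 : R).
Proof.
move=> a0 h0 hp c0; apply: (MLUR_pm E_MLUR hp _ c0) => n.
apply: le_trans (hp n); apply: koethe_le.
apply: filterS2 (filterI a0 (h0 n))
  (filterI (koethe_funDE a (h n)) (koethe_funBE a (h n))).
move=> t [at0 ht0] [-> ->]; rewrite [leRHS]ger0_norm ?addr_ge0//.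
by rewrite ler_norml; apply/andP; split; lra.
Qed.

(** The positive part of [m n - a] is a perturbation of [a] which does not
    increase the norm in the limit, and the negative part is below [r n]. *)
Lemma MLUR_koethe_minorant a (m r : E^nat) : `|a| = 1 ->
  (\forall t \ae mu, 0 <= kfun a t) ->
  (forall n, `|m n| <= 1) ->
  (forall n, \forall t \ae mu, 0 <= kfun (m n) t) ->
  (forall n, \forall t \ae mu, 0 <= kfun (r n) t) ->
  (forall n, \forall t \ae mu, kfun a t <= kfun (m n) t + kfun (r n) t) ->
  `|r n| @[n --> \oo] --> (0 : R) -> `|m n - a| @[n --> \oo] --> (0 : R).
Proof.
move=> a1 a0 m1 m0 r0 amr rcvg.
have /choice[h hE] : forall n, exists f : E,
    \forall t \ae mu, kfun f t = Num.max (kfun (m n - a) t) 0.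
  by move=> n; exact: koethe_pospart.
have {}hE n : \forall t \ae mu,
    kfun (h n) t = Num.max (kfun (m n) t - kfun a t) 0.
  by apply: filterS2 (hE n) (koethe_funBE (m n) a) => t -> ->.
have hcvg : `|h n| @[n --> \oo] --> (0 : R).
  apply: (@MLUR_koethe_monotone a h (fun n => `|r n|)) => // n.
    by apply: filterS (hE n) => t ->; rewrite le_max lexx orbT.
  rewrite a1; apply: (@le_trans _ _ `|m n + r n|); last first.
    by apply: le_trans (ler_normD _ _) _; rewrite lerD2r.
  apply: koethe_le; apply: filterS3 (filterI (hE n) (filterI (amr n) a0))
    (filterI (m0 n) (r0 n))
    (filterI (koethe_funDE a (h n)) (koethe_funDE (m n) (r n))).
  move=> t [ht [amrt a0t]] [m0t r0t] [-> ->]; rewrite ht.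
  rewrite ger0_norm; last by rewrite addr_ge0// le_max lexx orbT.
  rewrite ger0_norm ?addr_ge0//.
  by case: (leP (kfun (m n) t - kfun a t) 0) => ?; lra.
apply: (@cvg_dist_le _ _ _ (fun n => `|h n| + `|r n|)); last first.
  by rewrite -[0 in X in _ --> X]addr0; apply: cvgD.
apply: nearW => n; rewrite subr0 normr_id /=.
apply: le_trans (ler_normD (h n) (r n)).
apply: koethe_le; apply: filterS3 (filterI (hE n) (amr n)) (r0 n)
  (filterI (koethe_funDE (h n) (r n)) (koethe_funBE (m n) a)).
move=> t [ht amrt] r0t [-> ->]; rewrite ht.
rewrite [leRHS]ger0_norm; last by rewrite addr_ge0// le_max lexx orbT.
rewrite ler_norml.
by case: (leP (kfun (m n) t - kfun a t) 0) => ?; apply/andP; split; lra.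
Qed.

(** The means of [x n] and [y n] converge to [a] by [MLUR_koethe_minorant]; then
    MLUR itself makes [x n - y n] tend to zero. *)
Lemma MLUR_koethe_average (a : E) (x y r : E^nat) : `|a| = 1 ->
  (forall n, `|x n| = 1) -> (forall n, `|y n| = 1) ->
  (\forall t \ae mu, 0 <= kfun a t) ->
  (forall n, \forall t \ae mu, 0 <= kfun (x n) t) ->
  (forall n, \forall t \ae mu, 0 <= kfun (y n) t) ->
  (forall n, \forall t \ae mu, 0 <= kfun (r n) t) ->
  (forall n, \forall t \ae mu,
    kfun a t <= 2^-1 * (kfun (x n) t + kfun (y n) t) + kfun (r n) t) ->
  `|r n| @[n --> \oo] --> (0 : R) ->
  `|x n - a| @[n --> \oo] --> (0 : R) /\ `|y n - a| @[n --> \oo] --> (0 : R).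
Proof.
move=> a1 x1 y1 a0 x0 y0 r0 axyr rcvg.
pose m n := 2^-1 *: (x n + y n).
have mE n : \forall t \ae mu,
  kfun (m n) t = 2^-1 * (kfun (x n) t + kfun (y n) t).
  apply: filterS2 (koethe_funZE 2^-1 (x n + y n)) (koethe_funDE (x n) (y n)).
  by move=> t -> ->.
have mcvg : `|m n - a| @[n --> \oo] --> (0 : R).
  apply: (MLUR_koethe_minorant a1 a0 _ _ r0 _ rcvg) => n.
  - rewrite normrZ gtr0_norm; last by lra.
    by have := ler_normD (x n) (y n); rewrite x1 y1; lra.
  - by apply: filterS3 (mE n) (x0 n) (y0 n) => t -> ? ?; lra.
  - by apply: filterS2 (mE n) (axyr n) => t ->.
have xy : `|x n - y n| @[n --> \oo] --> (0 : R).
  by apply: (E_MLUR x1 y1 a1); under eq_fun do rewrite distrC.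
have sum0 : `|m n - a| + `|x n - y n| @[n --> \oo] --> (0 : R).
  by rewrite -[0 in X in _ --> X]addr0; apply: cvgD.
have half (z : E) : `|2^-1 *: z| <= `|z|.
  by rewrite normrZ gtr0_norm; have := normr_ge0 z; lra.
split; apply: cvg_dist_le sum0; apply: nearW => n; rewrite subr0 normr_id /=.
  apply: (le_trans _ (lerD (lexx _) (half _))).
  apply: (le_trans _ (ler_normD _ _)).
  have -> // : x n - a = m n - a + 2^-1 *: (x n - y n).
  rewrite addrAC /m -scalerDr addrACA subrr addr0 addr_double scalerA.
  by rewrite mulVf ?scale1r.
apply: (le_trans _ (lerD (lexx _) (half _))).
apply: (le_trans _ (ler_normB _ _)).
have -> // : y n - a = m n - a - 2^-1 *: (x n - y n).
rewrite addrAC /m -scalerBr opprB [x n + _ + _]addrC subrKA addr_double scalerA.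
by rewrite mulVf ?scale1r.
Qed.

End MLUR_koethe.

(** * Order continuity *)

Section order_continuity.
Context {R : realType} d {T : measurableType d}.
Context {mu : {measure set T -> \bar R}} (E : koetheSpace mu).
Hypothesis E_MLUR : MLUR E.

Local Notation kfun := (@koethe_fun R d T mu E).
Local Notation restr := (@koethe_restr R d T mu E).
Implicit Types (e : E) (A : (set T)^nat).

(** The condition makes the restrictions a Cauchy sequence.  Its limit vanishes
    on the complement of each [A m], because restriction is continuous, hence
    vanishes everywhere. *)
Lemma koethe_restr_cauchy_cvg0 e A : (forall n, measurable (A n)) ->
  {homo A : m n / (m <= n)%N >-> n `<=` m} -> \bigcap_n A n = set0 ->
  (forall c : R, 0 < c -> exists N, forall n, (N <= n)%N ->
     `|restr (A N `\` A n) e| < c) ->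
  `|restr (A n) e| @[n --> \oo] --> (0 : R).
Proof.
move=> mA homoA A0 eA.
have sub n m : (n <= m)%N ->
  restr (A n) e - restr (A m) e = restr (A n `\` A m) e.
  move=> nm; rewrite -{1}(setDUK (homoA _ _ nm)) setUC koethe_restrD ?addrK//.
    exact: measurableD.
  by apply/disj_setPLR => t [].
have [l sl] : exists l : E, restr (A n) e @[n --> \oo] --> l.
  suff : cvg (restr (A n) e @[n --> \oo]) by move=> ?;
    exists (lim (restr (A n) e @[n --> \oo])).
  apply: cauchy_cvg; apply/cauchy_exP => c c0.
  have [N NE] := eA _ c0; exists (restr (A N) e); exists N => // n /= Nn.
  by rewrite -ball_normE /= sub//; exact: NE.
suff l0 : l = 0 by rewrite l0 in sl; rewrite -(normr0 E); exact: cvg_norm.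
have lA m : restr (~` A m) l = 0.
  apply/normr0_eq0/eqP; rewrite eq_le normr_ge0 andbT.
  have : `|restr (A n) e - l| @[n --> \oo] --> (0 : R) by exact: normB_cvg.
  move=> /cvgrPdistC_lt h; apply/ler_addgt0Pl => c /h[N _ /(_ (maxn N m))].
  rewrite /= leq_maxl => /(_ isT);
    rewrite subr0 normr_id addr0 distrC => /ltW lc.
  apply: le_trans lc; apply: (le_trans _ (koethe_restr_le _ (measurableC (mA
    m)))).
  rewrite koethe_restrB; last exact: measurableC.
  set n := maxn N m; suff ->
    : restr (~` A m) (restr (A n) e) = 0 by rewrite subr0.
  apply: koethe_fun_inj; rewrite ae_eqT.
  apply: filterS3 (koethe_restrE (restr (A n) e) (measurableC (mA m)))
    (koethe_restrE e (mA n)) (koethe_fun0 E) => t -> -> /(_ I) ->.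
  rewrite mulrA -[_ * \1__ t]/((\1_(~` A m) \* \1_(A n)) t) -indicI (_ : ~` A m
    `&` A n = set0); last first.
    by rewrite setIC; apply/disjoints_subset; rewrite setCK; apply: homoA;
      exact: leq_maxr.
  by rewrite indic0 /= mul0r.
apply: koethe_fun_inj; rewrite ae_eqT.
have : \forall t \ae mu, forall m,
  kfun (restr (~` A m) l) t = \1_(~` A m) t * kfun l t.
  by apply: ae_foralln => m; apply: koethe_restrE; exact: measurableC.
apply: filterS2 (koethe_fun0 E) => t /(_ I) h0 h; rewrite h0.
have [m Am] : exists m, (~` A m) t.
  apply: contrapT => /forallNP hm; suff : set0 t by [].
  by rewrite -A0 => m _; apply: contrapT; exact: hm.
by have := h m; rewrite lA h0 indicE mem_set// mul1r.
Qed.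

(** Let [D r] be the union of the blocks whose index in an enumeration of the
    rationals is a number below [r].  The norm of the restriction of [e] to
    [D r] is a bounded nondecreasing function of the real [r], hence is right
    continuous at some [r].  Every interval to the right of [r] contains a
    rational, so there are blocks outside [D r] whose addition to [D r]
    increases the norm arbitrarily little; by [MLUR_koethe_monotone] the
    restriction to such blocks is small. *)
Lemma koethe_disjoint_cvg0 e A (c : R) : (forall n, measurable (A n)) ->
  trivIset setT A -> 0 < c -> exists n, `|restr (A n) e| < c.
Proof.
move=> mA tA c0; apply: contrapT => /forallNP h.
have {}h n : c <= `|restr (A n) e| by rewrite leNgt; apply/negP.
have [f fe f_abs] := koethe_norm_abs e.
have f0 : \forall t \ae mu, 0 <= kfun f t by apply: filterS f_abs => t ->.
have restr_f B : measurable B -> `|restr B f| = `|restr B e|.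
  move=> mB; apply/eqP; rewrite eq_le; apply/andP; split; apply: koethe_le;
  apply: filterS3 (koethe_restrE e mB) (koethe_restrE f mB) f_abs => t -> -> ->;
  by rewrite !normrM normr_id.
pose q (n : nat) : R := ratr (odflt 0 (unpickle n)).
(* The chain of sets has a continuum of members, although the blocks are
   countable: this is where rational indices matter. *)
pose D (r : R) := \bigcup_(n in [set n | q n < r]) A n.
have mD r : measurable (D r) by exact: bigcup_measurable.
have DS (r s : R) : r <= s -> D r `<=` D s.
  by move=> rs t [n /= qr At]; exists n => //=; exact: lt_le_trans rs.
have [r rcont] := @nondecreasing_right_continuity_point R
  (fun r => `|restr (D r) f|) `|f|
  (fun r s rs => koethe_restrS f (mD r) (mD s) (DS _ _ rs))
  (fun r => introT andP (conj (normr_ge0 _) (koethe_restr_le f (mD r)))).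
have /choice[k hk] : forall n, exists k, r <= q k /\
    `|restr (D r) f + restr (A k) f| <= `|restr (D r) f| + n.+1%:R^-1.
  move=> n; have [s rs fs] := rcont n.+1%:R^-1 ltac:(by rewrite invr_gt0).
  have [x /[!inE]/= /andP[rx xs]] := rat_in_itvoo rs.
  have qx : q (pickle x) = ratr x by rewrite /q pickleK.
  exists (pickle x); split; first by rewrite qx ltW.
  rewrite -koethe_restrD//; last first.
    apply/disj_setPLR => t [n' /= qn' An't] Axt; suff n'x : n' = pickle x.
      by move: qn'; rewrite n'x qx ltNge (ltW rx).
    by apply: tA => //; exists t.
  apply: le_trans fs; apply: koethe_restrS => //; first exact: measurableU.
  move=> t [|Axt]; first exact/DS/ltW.
  by exists (pickle x) => //=; rewrite qx.
have restr_ge0 B : measurable B -> \forall t \ae mu, 0 <= kfun (restr B f) t.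
  move=> mB; apply: filterS2 (koethe_restrE f mB) f0 => t -> ft0.
  by rewrite mulr_ge0.
have : `|restr (A (k n)) f| @[n --> \oo] --> (0 : R).
  apply: (@MLUR_koethe_monotone _ _ _ _ _ E_MLUR (restr (D r) f)
    (fun n => restr (A (k n)) f) (fun n => n.+1%:R^-1)).
  - exact: restr_ge0.
  - by move=> n; exact: restr_ge0.
  - by move=> n; have [] := hk n.
  - exact: cvg_harmonic.
move=> /cvgrPdistC_lt/(_ _ c0)[N _ /(_ N (leqnn N))] /=.
by rewrite subr0 normr_id restr_f// ltNge h.
Qed.

(** Otherwise the restrictions would not be Cauchy, and differences of the sets
    along a subsequence would be disjoint blocks on which [e] has norm at least
    [c]. *)
Theorem MLUR_order_continuous e A : (forall n, measurable (A n)) ->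
  {homo A : m n / (m <= n)%N >-> n `<=` m} -> \bigcap_n A n = set0 ->
  `|restr (A n) e| @[n --> \oo] --> (0 : R).
Proof.
move=> mA homoA A0; apply: koethe_restr_cauchy_cvg0 => // c c0.
apply: contrapT => /forallNP h.
have {}h N : exists n, (N < n)%N /\ c <= `|restr (A N `\` A n) e|.
  have /existsNP[n /not_implyP[Nn hn]] := h N.
  exists n; split; last by rewrite leNgt; apply/negP.
  rewrite ltn_neqAle Nn andbT; apply/eqP => Nn'; apply: hn.
  rewrite -Nn' setDv; suff -> : restr set0 e = 0 by rewrite normr0.
  apply: koethe_fun_inj; rewrite ae_eqT.
  apply: filterS2 (koethe_restrE e measurable0) (koethe_fun0 E) => t ->
    /(_ I) ->.
  by rewrite indic0 mul0r.
have [g hg] := choice h.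
pose k j := iter j g 0%N.
have kS i j : (i <= j)%N -> (k i <= k j)%N.
  move=> ij; apply: (homo_leq (r := leq)) ij => //; first exact: leq_trans.
  by move=> n; apply/ltnW; rewrite /k iterS; have [] := hg (iter n g 0%N).
have [||j] := @koethe_disjoint_cvg0 e (fun j =>
  A (k j) `\` A (k j.+1)) c _ _ c0.
- by move=> j; exact: measurableD.
- apply: ltn_trivIset => i j ji;
    apply/eqP/negPn/negP => /set0P[t [[_ Aj] [Ai _]]].
  by apply: Aj; exact: homoA (kS _ _ ji) _ Ai.
- by apply/negP; rewrite -leNgt; have [_] := hg (k j).
Qed.

End order_continuity.

(** * Elements of a Koethe-Bochner space as functions *)

Section koethe_bochner_elements.
Context {R : realType} d {T : measurableType d}.
Context {mu : {measure set T -> \bar R}} (E : koetheSpace mu).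
Context (X : normedModType R).

Local Notation kfun := (@koethe_fun R d T mu E).
Implicit Types (x y z : koetheBochner E X) (e : E) (A B : set T).

Definition kbfun x : T -> X := repr x : koetheBochnerFun E X.

Lemma kbfun_eq x y : (\forall t \ae mu, kbfun x t = kbfun y t) -> x = y.
Proof.
move=> xy; rewrite -[x]reprK -[y]reprK; apply/koethe_bochner_eqP.
by rewrite ae_eqT.
Qed.

Lemma kbfun_pi (f : koetheBochnerFun E X) :
  \forall t \ae mu, kbfun (\pi_(koetheBochner E X)%qT f) t = f t.
Proof. by have := koethe_bochner_reprK f; rewrite ae_eqT. Qed.

Lemma kbfunDE x y : \forall t \ae mu, kbfun (x + y) t = kbfun x t + kbfun y t.
Proof.
have := kbfun_pi (repr x + repr y).
by rewrite -koethe_bochner_piD !reprK.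
Qed.

Lemma kbfunZE (a : R) x : \forall t \ae mu, kbfun (a *: x) t = a *: kbfun x t.
Proof.
have := kbfun_pi (a *: repr x).
by rewrite -koethe_bochner_piZ !reprK.
Qed.

Lemma kbfunBE x y : \forall t \ae mu, kbfun (x - y) t = kbfun x t - kbfun y t.
Proof.
rewrite -scaleN1r; apply: filterS2 (kbfunDE x (-1 *: y)) (kbfunZE (-1) y).
by move=> t -> ->; rewrite scaleN1r.
Qed.

Lemma kbfun0E : \forall t \ae mu, kbfun 0 t = 0.
Proof. by apply: filterS (kbfunBE 0 0) => t; rewrite subr0 subrr. Qed.

Lemma kbfun_norm_exists x : exists e, (\forall t \ae mu,
  kfun e t = `|kbfun x t|) /\
  `|e| = `|x|.
Proof.
have [e he] := koethe_bochner_fun_norm (repr x); exists e; split.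
  by rewrite -ae_eqT.
by rewrite -(koethe_bochner_normE he) reprK.
Qed.

Definition kbnorm x : E := sval (cid (kbfun_norm_exists x)).

Lemma kbnormE x : \forall t \ae mu, kfun (kbnorm x) t = `|kbfun x t|.
Proof. by have [] := svalP (cid (kbfun_norm_exists x)). Qed.

Lemma norm_kbnorm x : `|kbnorm x| = `|x|.
Proof. by have [] := svalP (cid (kbfun_norm_exists x)). Qed.

Lemma kbnorm_ge0 x : \forall t \ae mu, 0 <= kfun (kbnorm x) t.
Proof. by apply: filterS (kbnormE x) => t ->. Qed.

Lemma kb_le x e : (\forall t \ae mu,
  `|kbfun x t| <= `|kfun e t|) -> `|x| <= `|e|.
Proof.
move=> xe; rewrite -norm_kbnorm; apply: koethe_le.
by apply: filterS2 xe (kbnormE x) => t ? ->; rewrite normr_id.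
Qed.

Lemma kb_exists (f : T -> X) e : bochner_measurable mu f ->
  (\forall t \ae mu, `|f t| <= `|kfun e t|) ->
  exists x, \forall t \ae mu, kbfun x t = f t.
Proof.
move=> mf fe; have [h hf _] := koethe_norm_le mf fe.
have fP : f \in @koethe_bochner_pred _ _ _ _ E X by rewrite inE; split => //;
  exists h.
by exists (\pi_(koetheBochner E X)%qT (KoetheBochnerFun fP)); exact: kbfun_pi.
Qed.

Lemma bochner_measurable_indicM A (f : T -> X) : measurable A ->
  bochner_measurable mu f ->
    bochner_measurable mu (fun t => (\1_A t : R) *: f t).
Proof.
move=> mA [s ss sf]; exists (fun n t => (\1_A t : R) *: s n t) => [n|].
  have sA : simple_fun (\1_A : T -> R).
    split=> [|r].
      apply: (@sub_finite_set _ _ [set (0 : R); 1]) => [_ [t _ <-]|].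
        by rewrite indicE; case: (_ \in _) => /=; [right|left].
      by rewrite finite_setU; split; exact: finite_set1.
    by rewrite -[X in measurable X]setTI; exact: (measurable_indic mA).
  have [? m] := simple_fun_comp2 (fun (a : R) (v : X) => a *: v) sA (ss n).
  by split.
by apply: filterS sf => t sf; exact: cvgZr.
Qed.

Lemma kb_restr_exists A x : measurable A ->
  exists y, \forall t \ae mu, kbfun y t = (\1_A t : R) *: kbfun x t.
Proof.
move=> mA; apply: (@kb_exists _ (kbnorm x)).
  apply: bochner_measurable_indicM => //.
  exact: koethe_bochner_fun_measurable.
apply: filterS (kbnormE x) => t ->; rewrite normr_id normrZ ger0_norm ?ler0n//.
by rewrite ler_piMl// indicE; case: (_ \in _).
Qed.

Definition kb_restr A x : koetheBochner E X :=
  xget 0 [set y | \forall t \ae mu, kbfun y t = (\1_A t : R) *: kbfun x t].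

Lemma kb_restrE A x : measurable A ->
  \forall t \ae mu, kbfun (kb_restr A x) t = (\1_A t : R) *: kbfun x t.
Proof.
move=> mA; rewrite /kb_restr; case: xgetP => [y -> //|h].
by have [y /h] := kb_restr_exists x mA.
Qed.

Lemma kb_restrT x : kb_restr setT x = x.
Proof.
apply: kbfun_eq; apply: filterS (kb_restrE x measurableT) => t ->.
by rewrite indicT scale1r.
Qed.

Lemma kb_restrD A x y : measurable A ->
  kb_restr A (x + y) = kb_restr A x + kb_restr A y.
Proof.
move=> mA; apply: kbfun_eq; apply: filterS3
  (filterI (kb_restrE x mA) (kb_restrE y mA))
  (filterI (kb_restrE (x + y) mA) (kbfunDE x y))
  (kbfunDE (kb_restr A x) (kb_restr A y)) => t [hx hy] [-> ->] ->.
by rewrite hx hy scalerDr.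
Qed.

Lemma kb_restrZ A (a : R) x : measurable A ->
  kb_restr A (a *: x) = a *: kb_restr A x.
Proof.
move=> mA; apply: kbfun_eq; apply: filterS3
  (filterI (kb_restrE x mA) (kb_restrE (a *: x) mA)) (kbfunZE a x)
  (kbfunZE a (kb_restr A x)) => t [hx ->] -> ->.
by rewrite hx !scalerA mulrC.
Qed.

Lemma kb_restrI A B x : measurable A -> measurable B ->
  kb_restr A (kb_restr B x) = kb_restr (A `&` B) x.
Proof.
move=> mA mB; apply: kbfun_eq; apply: filterS3 (kb_restrE (kb_restr B x) mA)
  (kb_restrE x mB) (kb_restrE x (measurableI _ _ mA mB)) => t -> -> ->.
by rewrite scalerA indicI.
Qed.

Lemma kb_restrU A B x : measurable A -> measurable B -> A `&` B = set0 ->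
  kb_restr (A `|` B) x = kb_restr A x + kb_restr B x.
Proof.
move=> mA mB AB; apply: kbfun_eq; apply: filterS3
  (filterI (kb_restrE x mA) (kb_restrE x mB))
  (kb_restrE x (measurableU _ _ mA mB))
  (kbfunDE (kb_restr A x) (kb_restr B x)) => t [hA hB] -> ->.
rewrite hA hB -scalerDl; congr (_ *: _).
rewrite !indicE in_setU; have [tA|_] := boolP (t \in A); last by rewrite add0r.
rewrite memNset ?addr0// => tB; suff : set0 t by [].
by rewrite -AB; split => //; exact: set_mem.
Qed.

Lemma kb_restr0 A x : measurable A -> mu A = 0%E -> kb_restr A x = 0.
Proof.
move=> mA A0; apply: kbfun_eq; have : \forall t \ae mu, (~` A) t.
  by exists A; split => // t /=; rewrite notK.
apply: filterS3 (kb_restrE x mA) kbfun0E => t -> -> At.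
by rewrite indicE memNset// scale0r.
Qed.

Lemma kb_restr_norm A x : measurable A ->
  `|kb_restr A x| <= `|koethe_restr A (kbnorm x)|.
Proof.
move=> mA; apply: kb_le; apply: filterS3 (kb_restrE x mA)
  (koethe_restrE (kbnorm x) mA) (kbnormE x) => t -> -> ->.
by rewrite normrZ normrM normr_id.
Qed.

End koethe_bochner_elements.

(** * Densities of a functional *)

Section density.
Context {R : realType} d {T : measurableType d}.
Context {mu : {sigma_finite_measure set T -> \bar R}} (E : koetheSpace mu).
Context (X : normedModType R).
Hypothesis E_MLUR : MLUR E.
Variable F : koetheBochner E X -> R.
Hypothesis F_scalar : scalar F.
Hypothesis F_le : forall z, `|F z| <= `|z|.

Implicit Types (x y z : koetheBochner E X) (phi : T -> R) (A B : set T).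

Definition density z phi :=
  mu.-integrable setT (EFin \o phi) /\
  forall A, measurable A ->
    (F (kb_restr A z))%:E = (\int[mu]_(t in A) (phi t)%:E)%E.

(** The remainders of the series are values of [F] at restrictions of [z] to
    sets that decrease to the empty set, hence order continuity makes them
    small. *)
Lemma kb_restr_sigma_additive z :
  semi_sigma_additive (fun A => (F (kb_restr A z))%:E).
Proof.
move=> A mA tA mUA.
pose U n := \bigcup_(k in [set k | (n <= k)%N]) A k.
pose I n := \big[setU/set0]_(0 <= k < n) A k.
have mU n : measurable (U n) by exact: bigcup_measurable.
have mI n : measurable (I n) by exact: bigsetU_measurable.
have IU0 n : I n `&` U n = set0.
  rewrite /I big_mkord -bigcup_mkord; apply/seteqP; split => // t.
  move=> [[i /= ni Ait] [j /= nj Ajt]]; have ij : i = j by apply: tA => //;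
    exists t.
  by move: nj; rewrite -ij leqNgt ni.
have sumI n : \sum_(0 <= i < n) (F (kb_restr (A i) z))%:E =
  (F (kb_restr (I n) z))%:E.
  elim: n => [|n ih].
    by rewrite /I !big_geq// kb_restr0 ?scalar0.
  rewrite big_nat_recr//= ih -EFinD -scalarD// -kb_restrU//.
    by congr (F (kb_restr _ z))%:E; rewrite [in RHS]/I big_nat_recr.
  apply/seteqP; split => // t [It At]; rewrite -(IU0 n).
  by split => //; exists n => /=.
have split_sum n :  F (kb_restr (\bigcup_k A k) z) =
  F (kb_restr (I n) z) + F (kb_restr (U n) z).
  rewrite -scalarD// -kb_restrU//.
    congr (F (kb_restr _ z)); rewrite /I big_mkord -bigcup_mkord.
    rewrite -bigcup_setU; congr (\bigcup_(k in _) A k).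
    by apply/seteqP; split => // k _ /=; case: (leqP n k) => ?; [right|left].
have Ucvg : `|koethe_restr (U n) (kbnorm z)| @[n --> \oo] --> (0 : R).
  apply: MLUR_order_continuous => //.
    by move=> m n mn t [k /= nk At]; exists k => //=; exact: leq_trans nk.
  apply/seteqP; split => // t Ut; have [k _ Akt] := Ut 0%N Logic.I.
  have [k' /= kk' Ak't] := Ut k.+1 Logic.I.
  have kE : k = k' by apply: tA => //; exists t.
  by rewrite -kE ltnn in kk'.
rewrite (_ : (fun n => _) = EFin \o (fun n => F (kb_restr (I n) z)));
  last first.
  by apply/funext => n; rewrite sumI.
apply: cvg_EFin; first exact: nearW.
apply: cvg_dist_le Ucvg; apply: nearW => n.
rewrite /= (split_sum n) opprD addrA subrr add0r normrN.
by apply: le_trans (F_le _) _; exact: kb_restr_norm.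
Qed.

Lemma density_exists z : exists phi, density z phi.
Proof.
pose nu A := (F (kb_restr A z))%:E.
have nu0 : nu set0 = 0%E by rewrite /nu kb_restr0// scalar0.
have nufin A : measurable A -> nu A \is a fin_num by [].
pose nuc : {charge set T -> \bar R} :=
  HB.pack nu (isCharge.Build _ T R nu nu0 nufin (@kb_restr_sigma_additive z)).
have dom : nuc `<< mu.
  move=> N N0 A mA AN; rewrite /= /nu kb_restr0 ?scalar0//; exact: N0.
pose g := Radon_Nikodym nuc mu.
have gfin t : g t \is a fin_num by exact: Radon_Nikodym_fin_num.
have gE : EFin \o (fine \o g) = g by apply/funext => t /=; rewrite fineK.
exists (fine \o g); split; first by rewrite gE; exact: Radon_Nikodym_integrable.
move=> A mA; rewrite -[LHS]/(nuc A) (Radon_Nikodym_integral dom mA).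
by apply: eq_integral => t _; rewrite /= fineK.
Qed.

Lemma density_measurable z phi : density z phi -> measurable_fun setT phi.
Proof. by move=> [/measurable_int/measurable_EFinP]. Qed.

Lemma densityD x y phi psi : density x phi -> density y psi ->
  density (x + y) (fun t => phi t + psi t).
Proof.
move=> [iphi phiE] [ipsi psiE]; split.
  by rewrite (_ : _ \o _ = (EFin \o phi) \+ (EFin \o psi))//;
    exact: integrableD.
move=> A mA; rewrite kb_restrD// scalarD// EFinD phiE// psiE//.
rewrite -integralD//; try exact: (integrableS measurableT).
Qed.

Lemma densityZ (a : R) x phi : density x phi ->
  density (a *: x) (fun t => a * phi t).
Proof.
move=> [iphi phiE]; split.
  rewrite (_ : _ \o _ = (fun t => a%:E * (EFin \o phi) t)%E)//.
  exact: integrableZl.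
move=> A mA; rewrite kb_restrZ// scalarZ// EFinM phiE//.
rewrite -integralZl//; exact: (integrableS measurableT).
Qed.

Lemma density_restr A x phi : measurable A -> density x phi ->
  density (kb_restr A x) (fun t => \1_A t * phi t).
Proof.
move=> mA dphi; have [iphi phiE] := dphi.
have h : (fun t => (\1_A t * phi t)%:E) = (EFin \o phi) \_ A.
  apply/funext => t; rewrite patchE indicE; case: (_ \in _);
    first by rewrite mul1r.
  by rewrite mul0r.
split; first by rewrite [X in _.-integrable _ X]h -integrable_mkcond//;
  exact: (integrableS measurableT).
move=> B mB; rewrite kb_restrI// phiE; last exact: measurableI.
by rewrite integral_mkcondr; apply: eq_integral => t _; rewrite -h.
Qed.

Lemma density_ext x phi psi : phi =1 psi -> density x phi -> density x psi.
Proof. by move=> /funext ->. Qed.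

Lemma density_simple (s : seq R) (A : R -> set T) x phi :
  (forall a, measurable (A a)) -> density x phi ->
  exists2 y, (\forall t \ae mu,
    kbfun y t = (\sum_(a <- s) a * \1_(A a) t) *: kbfun x t) &
    density y (fun t => (\sum_(a <- s) a * \1_(A a) t) * phi t).
Proof.
move=> mA dx; elim: s => [|a s [y yE dy]].
  exists (0 *: x).
    by apply: filterS (kbfunZE 0 x) => t ->; rewrite big_nil.
  by apply: density_ext (densityZ 0 dx) => t; rewrite big_nil.
exists (a *: kb_restr (A a) x + y).
  apply: filterS3 (filterI yE (kbfunDE (a *: kb_restr (A a) x) y))
    (kbfunZE a (kb_restr (A a) x)) (kb_restrE x (mA a)) => t [-> ->] -> ->.
  by rewrite big_cons scalerDl scalerA.
apply: density_ext (densityD (densityZ a (density_restr (mA a) dx)) dy) => t.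
by rewrite /= big_cons mulrDl mulrA.
Qed.

Import HBSimple.

Lemma density_sfun (s : {sfun T >-> R}) x phi : density x phi ->
  exists2 y, (\forall t \ae mu, kbfun y t = s t *: kbfun x t) &
    density y (fun t => s t * phi t).
Proof.
move=> dx; have sE t : s t =
  \sum_(a <- finmap.enum_fset (fset_set (range s))) a * \1_(s @^-1` [set a]) t.
  by rewrite {1}[s t](fimfunE s) fsbig_finite.
have [//|y yE dy] := @density_simple (finmap.enum_fset (fset_set (range s)))
  (fun a => s @^-1` [set a]) x phi _ dx.
exists y; first by apply: filterS yE => t; rewrite -sE.
by apply: density_ext dy => t; rewrite -sE.
Qed.

(** [y] is [x] with its sign changed where [phi] is negative, restricted to
    [A]. *)
Lemma density_abs A x phi : measurable A -> density x phi ->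
  exists2 y, (\forall t \ae mu, `|kbfun y t| = \1_A t * `|kbfun x t|) &
    (F y)%:E = (\int[mu]_(t in A) `|phi t|%:E)%E.
Proof.
move=> mA dx; have mphi := density_measurable dx.
pose P := [set t | 0 <= phi t].
have mP : measurable P.
  by rewrite /P -[X in measurable X]setTI; apply: measurable_fun_le.
have iphi B : measurable B -> mu.-integrable B (EFin \o phi).
  by move=> mB; apply: (integrableS measurableT) => //; case: dx.
exists (kb_restr (A `&` P) x - kb_restr (A `\` P) x).
  apply: filterS3 (kbfunBE (kb_restr (A `&` P) x) (kb_restr (A `\` P) x))
    (kb_restrE x (measurableI _ _ mA mP)) (kb_restrE x (measurableD mA mP)).
  move=> t -> -> ->; rewrite !indicE in_setI in_setD.
  by case: (t \in A); case: (t \in P) => /=;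
    rewrite ?scale1r ?scale0r ?mul1r ?mul0r ?subr0 ?sub0r ?normrN ?normr0.
rewrite scalarB// EFinB !dx.2; [|exact: measurableD|exact: measurableI].
rewrite -[in RHS](setUIDK A P) ge0_integral_setU//=.
- congr (_ + _)%E.
    by apply: eq_integral => t /[!inE] -[_ Pt]; rewrite ger0_norm.
  rewrite -integralN; last first.
    exact: (integrable_add_def (measurableD mA mP) (iphi _ (measurableD mA
      mP))).
  apply: eq_integral => t /[!inE] -[_ /negP]; rewrite -ltNge => phi0.
  by rewrite ltr0_norm.
- exact: measurableI.
- exact: measurableD.
- by apply/measurable_EFinP; apply: measurableT_comp => //;
    exact: measurable_funTS.
- by apply/disj_setPLR => t [_ Pt] [].
Qed.

End density.

(** * The modulus of a functional and its admissible weights *)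

Section modulus.
Context {R : realType} d {T : measurableType d}.
Context {mu : {sigma_finite_measure set T -> \bar R}} (E : koetheSpace mu).
Context (X : normedModType R).
Variable F : koetheBochner E X -> R.
Hypothesis F_scalar : scalar F.
Hypothesis F_le : forall z, `|F z| <= `|z|.

Local Notation kfun := (@koethe_fun R d T mu E).
Implicit Types (x y z k : koetheBochner E X) (e : E) (A B : set T) (r : T -> R).

Definition kb_interval A e : set (koetheBochner E X) :=
  [set k | \forall t \ae mu, `|kbfun k t| <= \1_A t * `|kfun e t|].

(** The value at [`|e|], restricted to [A], of the lattice modulus of [F]. *)
Definition modulus A e := sup [set F k | k in kb_interval A e].

Lemma kb_interval0 A e : kb_interval A e 0.
Proof.
by apply: filterS (@kbfun0E _ _ _ _ E X) => t ->; rewrite normr0 mulr_ge0.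
Qed.

Let modulus_bound A e k : kb_interval A e k -> F k <= `|e|.
Proof.
move=> kA; apply: le_trans (ler_norm _) (le_trans (F_le k) _).
apply: kb_le; apply: filterS kA => t /le_trans; apply.
by rewrite ler_piMl// indicE; case: (_ \in _).
Qed.

Lemma modulus_le A e : modulus A e <= `|e|.
Proof.
apply: ge_sup; first by exists (F 0), 0 => //; exact: kb_interval0.
by move=> _ [k kA <-]; exact: modulus_bound kA.
Qed.

Lemma le_modulus A e k : kb_interval A e k -> F k <= modulus A e.
Proof.
move=> kA; apply: ub_le_sup; last by exists k.
by exists `|e| => _ [k' kA' <-]; exact: modulus_bound kA'.
Qed.

(** Elements of the intervals over disjoint sets add up to an element of the
    interval over the union. *)
Lemma modulus_superadditive A B e : A `&` B = set0 ->
  modulus A e + modulus B e <= modulus (A `|` B) e.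
Proof.
move=> AB; rewrite -lerBrDr; apply: ge_sup.
  by exists (F 0), 0 => //; exact: kb_interval0.
move=> _ [k kA <-]; rewrite lerBrDl -lerBrDr; apply: ge_sup.
  by exists (F 0), 0 => //; exact: kb_interval0.
move=> _ [k' kB <-]; rewrite lerBrDr -scalarD//; apply: le_modulus.
apply: filterS3 kA kB (kbfunDE k' k) => t kAt kBt ->.
apply: le_trans (ler_normD _ _) _; apply: le_trans (lerD kBt kAt) _.
rewrite -mulrDl ler_wpM2r// !indicE in_setU.
have [tA|tA] := boolP (t \in A); have [tB|tB] := boolP (t \in B) => //=;
  rewrite ?addr0 ?add0r// -natrD ler_nat.
suff : set0 t by []; rewrite -AB; split; exact: set_mem.
Qed.

(** Asking for the inequality on every set [A], rather than on the whole space,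
    is what makes the notion stable under maxima. *)
Definition admissible r := [/\ measurable_fun setT r, forall t, 0 <= r t &
  forall A e, measurable A ->
    (\int[mu]_(t in A) (r t * `|kfun e t|)%:E <= (modulus A e)%:E)%E].

Lemma measurable_weight r e : measurable_fun setT r ->
  measurable_fun setT (fun t => r t * `|kfun e t|).
Proof.
move=> mr; apply: measurable_funM => //; apply: measurableT_comp => //.
exact: measurable_koethe_fun.
Qed.

(** On the set where [r1] is the larger function the inequality is that of [r1],
    on the complement that of [r2]; superadditivity of the modulus puts the two
    together. *)
Lemma admissible_max r1 r2 : admissible r1 -> admissible r2 ->
  admissible (fun t => Num.max (r1 t) (r2 t)).
Proof.
move=> [m1 p1 a1] [m2 p2 a2]; split=> [||A e mA].
- exact: measurable_maxr.
- by move=> t; rewrite le_max p1.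
pose P := [set t | r2 t <= r1 t].
have mP : measurable P.
  by rewrite /P -[X in measurable X]setTI; exact: measurable_fun_le.
have mmax : measurable_fun setT (fun t => Num.max (r1 t) (r2 t) * `|kfun e t|).
  by apply: measurable_weight; exact: measurable_maxr.
rewrite -{1}(setUIDK A P) ge0_integral_setU//=.
- apply: (@le_trans _ _ ((modulus (A `&` P) e)%:E +
    (modulus (A `\` P) e)%:E)%E).
    apply: leeD.
      rewrite (@eq_integral _ _ _ _ _ (fun t => (r1 t * `|kfun e t|)%:E)).
        by apply: a1; exact: measurableI.
      by move=> t /[!inE] -[_ Pt]; rewrite max_l.
    rewrite (@eq_integral _ _ _ _ _ (fun t => (r2 t * `|kfun e t|)%:E)).
      by apply: a2; exact: measurableD.
    by move=> t /[!inE] -[_ /negP]; rewrite -ltNge => /ltW ?; rewrite max_r.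
  rewrite -EFinD lee_fin -[in leRHS](setUIDK A P).
  by apply: modulus_superadditive; apply/seteqP; split => // t [[_ ?] []].
- exact: measurableI.
- exact: measurableD.
- exact/measurable_EFinP/measurable_funTS.
- by move=> t _; rewrite lee_fin mulr_ge0// le_max p1.
- by apply/disj_setPLR => t [_ Pt] [].
Qed.

Lemma measurable_inv_norm e : measurable_fun setT (fun t => `|kfun e t|^-1).
Proof.
rewrite (_ : (fun t => _) = (@powR R ^~ (-1)) \o (fun t => `|kfun e t|));
  last first.
  by apply/funext => t /=; rewrite powR_inv1.
apply: measurableT_comp => //; apply: measurableT_comp => //.
exact: measurable_koethe_fun.
Qed.

Import HBSimple HBNNSimple.

(** The function [`|phi| / `|x|] multiplied by [`|e|] is the increasing limit of
    the functions [s n * `|phi|], where the simple functions [s n] increase to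
    [`|e| / `|x|].  The integral of [s n * `|phi|] over [A] is the value of [F]
    at [s n] times [x], up to signs, and this vector lies in the interval of
    [e]. *)
Lemma admissible_density x phi : density F x phi ->
  admissible (fun t => `|phi t| * `|kfun (kbnorm x) t|^-1).
Proof.
move=> dx; have mphi := density_measurable dx.
have mabs : measurable_fun setT (fun t => `|phi t|) by exact: measurableT_comp.
split=> [|t|A e mA].
- by apply: measurable_funM => //; exact: measurable_inv_norm.
- by rewrite mulr_ge0// invr_ge0.
(* Where x vanishes the inverse is zero, which is the right convention since
   the density of x is zero almost everywhere there. *)
pose c t := `|kfun (kbnorm x) t|^-1 * `|kfun e t|.
have c0 t : 0 <= c t by rewrite mulr_ge0// invr_ge0.
have mc : measurable_fun setT (EFin \o c).
  by apply/measurable_EFinP; apply: measurable_weight;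
    exact: measurable_inv_norm.
pose s n := nnsfun_approx measurableT mc n.
have sc t : (s n t)%:E @[n --> \oo] --> (c t)%:E.
  have f0 u : setT u -> (0 <= (EFin \o c) u)%E by rewrite lee_fin.
  exact: (cvg_nnsfun_approx measurableT mc f0 (x := t) Logic.I).
have snd t : nondecreasing_seq (fun n => s n t).
  by move=> m n mn; have /lefP := nd_nnsfun_approx measurableT mc mn.
have s_le n t : s n t <= c t.
  have st : s n t @[n --> \oo] --> c t by have /fine_cvgP[_] := sc t.
  rewrite -(cvg_lim _ st)//; apply: nondecreasing_cvgn_le => //.
  by apply/cvg_ex; exists (c t).
have s0 n t : 0 <= s n t by [].
pose g n t := (s n t * `|phi t|)%:E.
have gnd t : A t -> nondecreasing_seq (g ^~ t).
  by move=> _ m n mn; rewrite lee_fin ler_wpM2r//; exact: snd.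
have mg n : measurable_fun A (g n).
  by apply/measurable_EFinP/measurable_funTS; apply: measurable_funM.
have gcvg t : g n t @[n --> \oo] --> (`|phi t| * `|kfun (kbnorm x) t|^-1 *
  `|kfun e t|)%:E.
  rewrite -mulrA mulrC EFinM.
  under eq_fun do rewrite /g EFinM.
  by apply: cvgeM => //; exact: cvg_cst.
have := @cvg_monotone_convergence _ _ _ mu A mA g mg
  (fun n t _ => mulr_ge0 (s0 n t) (normr_ge0 (phi t))) gnd.
rewrite (_ : (\int[mu]_(x0 in A) limn (g^~ x0))%E = \int[mu]_(t in A)
    (`|phi t| * `|kfun (kbnorm x) t|^-1 * `|kfun e t|)%:E)%E; last first.
  by apply: eq_integral => t _; apply/cvg_lim.
move=> h; rewrite -(cvg_lim _ h)//; apply: lime_le; first exact: (cvgP _ h).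
apply: nearW => n; rewrite /=.
have [w wE dw] := density_sfun F_scalar (s n) dx.
have [y yE Fy] := density_abs F_scalar mA dw.
rewrite (_ : (\int[mu]_(t in A) g n t)%E = (F y)%:E); last first.
  by rewrite Fy; apply: eq_integral => t _;
    rewrite /g normrM (ger0_norm (s0 n t)).
rewrite lee_fin; apply: le_modulus.
apply: filterS3 yE wE (kbnormE x) => t -> -> ht.
rewrite ler_wpM2l// normrZ ger0_norm//;
  apply: le_trans (ler_wpM2r _ (s_le n t)) _ => //.
rewrite /c ht normr_id mulrAC; have [->|?] := eqVneq `|kbfun x t| 0.
  by rewrite mulr0 mul0r.
by rewrite mulVf// mul1r.
Qed.

End modulus.

(** * The least weight of countably many densities *)

Section modulus_density.
Context {R : realType} d {T : measurableType d}.
Context {mu : {sigma_finite_measure set T -> \bar R}} (E : koetheSpace mu).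
Context (X : normedModType R).
Variable F : koetheBochner E X -> R.
Hypothesis F_scalar : scalar F.
Hypothesis F_le : forall z, `|F z| <= `|z|.

Local Notation kfun := (@koethe_fun R d T mu E).
Implicit Types (e : E).

(** The space is covered by countably many sets of finite measure, whose
    indicator functions belong to [E]. *)
Lemma integrable_locally_fin (h : T -> \bar R) :
  measurable_fun setT h -> (forall t, (0 <= h t)%E) ->
  (forall e, (\int[mu]_t (h t * `|kfun e t|%:E) < +oo)%E) ->
  \forall t \ae mu, h t \is a fin_num.
Proof.
move=> mh h0 hfin; have [A AT mA] := sigma_finiteT mu.
have : \forall t \ae mu, forall n, A n t -> h t \is a fin_num.
  apply: ae_foralln => n; have [mAn An] := mA n.
  have [e he] := koethe_indic E mAn An.
  have : mu.-integrable setT (fun t => h t * `|kfun e t|%:E)%E.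
    apply/integrableP; split.
      apply: emeasurable_funM => //; apply/measurable_EFinP.
      by apply: measurableT_comp => //; exact: measurable_koethe_fun.
    rewrite (eq_integral (fun t => h t * `|kfun e t|%:E)%E) //.
    by move=> t _; rewrite gee0_abs// mule_ge0.
  move=> /(integrable_ae measurableT);
    apply: filterS2 he => t /(_ I) -> /(_ I) + At.
  by rewrite indicE mem_set//= normr1 mule1.
apply: filterS => t At; have : setT t by [].
by rewrite AT => -[n _] /At.
Qed.

(** The maxima of finitely many of the weights are admissible, and monotone
    convergence passes to their supremum.  The modulus being finite, so is the
    supremum almost everywhere. *)
Lemma admissible_sup (r : nat -> T -> R) : (forall q, admissible F (r q)) ->
  exists rho : T -> R, [/\ measurable_fun setT rho, forall t, 0 <= rho t,
    \forall t \ae mu, forall q, r q t <= rho t &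
    forall e, (\int[mu]_t (rho t * `|kfun e t|)%:E <= `|e|%:E)%E].
Proof.
move=> adm; pose m := fix m n := if n is n'.+1 then
  (fun t => Num.max (m n' t) (r n t)) else r 0%N.
have admm n : admissible F (m n).
  by elim: n => [|n ih] //=; exact: admissible_max.
have mm n : measurable_fun setT (m n) by case: (admm n).
have m0 n t : 0 <= m n t by case: (admm n).
have mnd t : nondecreasing_seq (fun n => (m n t)%:E).
  by apply/nondecreasing_seqP => n /=; rewrite lee_fin le_max lexx.
have rm n t : r n t <= m n t by case: n => //= n; rewrite le_max lexx orbT.
pose h t := limn (fun n => (m n t)%:E).
have hcvg t : (m n t)%:E @[n --> \oo] --> h t.
  exact: (ereal_nondecreasing_is_cvgn (mnd t)).
have h_ge n t : ((m n t)%:E <= h t)%E.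
  have := ereal_nondecreasing_cvgn (mnd t); rewrite /h => /cvg_lim -> //.
  by apply: ereal_sup_ubound; exists n.
have h0 t : (0 <= h t)%E by apply: le_trans (h_ge 0%N t); rewrite lee_fin.
have mh : measurable_fun setT h.
  apply: (@emeasurable_fun_cvg _ _ _ _ (fun n t => (m n t)%:E)) => // n.
  exact/measurable_EFinP.
have hint e : (\int[mu]_t (h t * `|kfun e t|%:E) <= `|e|%:E)%E.
  have := @cvg_monotone_convergence _ _ _ mu setT measurableT
    (fun n t => (m n t * `|kfun e t|)%:E)
    (fun n => (measurable_EFinP _ _).2 (measurable_weight e (mm n)))
    (fun n t _ => mulr_ge0 (m0 n t) (normr_ge0 (kfun e t))).
  rewrite (_ : (\int[mu]_(x0 in setT) limn _)%E =
    (\int[mu]_t (h t * `|kfun e t|%:E)))%E; last first.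
    apply: eq_integral => t _; apply/cvg_lim => //.
    under eq_fun do rewrite EFinM.
    by apply: cvgeZr => //; exact: hcvg.
  move=> /(_ (fun t _ n1 n2 n12 =>
    ler_wpM2r (normr_ge0 (kfun e t)) (mnd t n1 n2 n12))) H.
  rewrite -(cvg_lim _ H)//; apply: lime_le; first exact: (cvgP _ H).
  apply: nearW => n; have [_ _ /(_ setT e measurableT) admn] := admm n.
  by apply: le_trans admn _; rewrite lee_fin; exact: modulus_le.
have hfin : \forall t \ae mu, h t \is a fin_num.
  apply: integrable_locally_fin => // e.
  by apply: le_lt_trans (hint e) _; exact: ltry.
exists (fine \o h); split.
- by apply: measurableT_comp => //.
- by move=> t; rewrite fine_ge0.
- apply: filterS hfin => t ht q; rewrite -lee_fin /= fineK//.
  by apply: le_trans (h_ge q t); rewrite lee_fin.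
- move=> e; apply: le_trans (hint e); rewrite le_eqVlt; apply/orP; left;
    apply/eqP.
  apply: ge0_ae_eq_integral => //.
  + by apply/measurable_EFinP/measurable_weight; apply: measurableT_comp.
  + apply: emeasurable_funM => //; apply/measurable_EFinP.
    by apply: measurableT_comp => //; exact: measurable_koethe_fun.
  + by move=> t _; rewrite lee_fin mulr_ge0// fine_ge0.
  + by move=> t _; rewrite mule_ge0.
  + by apply: filterS hfin => t ht _; rewrite EFinM fineK.
Qed.

End modulus_density.

(** * Disintegration of a functional *)

Section integer_combinations.
Context {R : realType} (V : normedModType R).
Variables (v : nat -> V) (s : nat -> R) (c : R).
Hypothesis c0 : 0 <= c.

(** Integer coefficients keep the family of conditions countable, so that it can
    hold outside one null set. *)
Definition int_comb_bounded := forall a : seq int,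
  `|\sum_(i < size a) (a`_i)%:~R * s i| <= c * `|\sum_(i < size a) (a`_i)%:~R *:
    v i|.

(** Real coefficients [a i] are replaced by the integer parts of [N * a i]: the
    inequality multiplied by [N] then holds up to an error that does not depend
    on [N]. *)
Lemma real_comb_bounded : int_comb_bounded -> forall n (a : nat -> R),
  \sum_(i < n) a i * s i <= c * `|\sum_(i < n) a i *: v i|.
Proof.
move=> bnd n a; rewrite leNgt; apply/negP; rewrite -subr_gt0.
set S := \sum_(i < n) a i * s i; set W := \sum_(i < n) a i *: v i.
set D := S - c * `|W| => D0.
set B := \sum_(i < n) `|s i|; set B' := \sum_(i < n) `|v i|.
suff key N : N%:R * D <= B + c * B'.
  have := key (Num.truncn ((B + c * B') / D)).+1.
  by rewrite leNgt -ltr_pdivrMr// truncnS_gt.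
pose b i : int := Num.floor (N%:R * a i).
have frac i : `|N%:R * a i - (b i)%:~R| <= 1.
  have := floor_le (N%:R * a i); have := floorD1_gt (N%:R * a i).
  by rewrite intrD ler_norml -/(b i) => ? ?; apply/andP; split; lra.
have := bnd (mkseq b n); rewrite size_mkseq.
under eq_bigr do rewrite nth_mkseq//.
under [in leRHS]eq_bigr do rewrite nth_mkseq//.
set S' := \sum_(i < n) _; set W' := \sum_(i < n) _ => SW.
have SB : N%:R * S - S' <= B.
  rewrite /S mulr_sumr -sumrB; apply: ler_sum => i _.
  rewrite mulrA -mulrBl; apply: le_trans (ler_norm _) _.
  by rewrite normrM ler_piMl.
have WB : `|W' - N%:R *: W| <= B'.
  rewrite /W scaler_sumr -sumrB; apply: le_trans (ler_norm_sum _ _ _) _.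
  by apply: ler_sum => i _; rewrite scalerA -scalerBl normrZ distrC ler_piMl.
have WN : `|W'| <= N%:R * `|W| + B'.
  rewrite -[W'](subrK (N%:R *: W)) addrC; apply: le_trans (ler_normD _ _) _.
  by rewrite lerD// normrZ ger0_norm.
have cW : c * `|W'| <= c * (N%:R * `|W| + B') by rewrite ler_wpM2l.
have := ler_norm S'; rewrite /D mulrBr; lra.
Qed.

(** The cone of constraints is the real span of the pairs [(v i, s i)]. *)
Lemma functional_of_int_comb : int_comb_bounded -> exists f : V -> R,
  [/\ scalar f, forall x, `|f x| <= c * `|x| & forall i, f (v i) = s i].
Proof.
move=> /real_comb_bounded bnd.
pose K : set (V * R) := [set u | exists n (a : nat -> R),
  u = (\sum_(i < n) a i *: v i, \sum_(i < n) a i * s i)].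
have KN u : K u -> K (- u).
  move=> [n [a ->]]; exists n, (fun i => - a i).
  rewrite [LHS]/GRing.opp /= /add_pair; congr (_, _); rewrite -sumrN.
    by apply: eq_bigr => i _; rewrite scaleNr.
  by apply: eq_bigr => i _; rewrite mulNr.
have widen n m (a : nat -> R) : (n <= m)%N ->
    (\sum_(i < n) a i *: v i, \sum_(i < n) a i * s i) =
    (\sum_(i < m) (if (i < n)%N then a i else 0) *: v i,
     \sum_(i < m) (if (i < n)%N then a i else 0) * s i).
  move=> nm; congr (_, _).
    rewrite (big_ord_widen m (fun i => a i *: v i) nm) big_mkcond.
    by apply: eq_bigr => i _; case: ifP => _; rewrite ?scale0r.
  rewrite (big_ord_widen m (fun i => a i * s i) nm) big_mkcond.
  by apply: eq_bigr => i _; case: ifP => _; rewrite ?mul0r.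
have cK : convex_cone K; first split.
- by exists 0%N, (fun=> 0); rewrite !big_ord0.
- move=> _ _ [n [a ->]] [m [b ->]].
  rewrite (widen _ _ _ (leq_maxl n m)) (widen _ _ _ (leq_maxr n m)).
  exists (maxn n m), (fun i => (if (i < n)%N then a i else 0) +
                               (if (i < m)%N then b i else 0)).
  rewrite [LHS]/GRing.add /= /add_pair /=; congr (_, _); rewrite -big_split.
    by apply: eq_bigr => i _; rewrite scalerDl.
  by apply: eq_bigr => i _; rewrite mulrDl.
- move=> b _ b0 [n [a ->]]; exists n, (fun i => b * a i).
  congr (_, _); rewrite /= ?scaler_sumr ?mulr_sumr.
    by apply: eq_bigr => i _; rewrite scalerA.
  by apply: eq_bigr => i _; rewrite mulrA.
have [|f [lf fc fK]] := @hahn_banach_cone _ _ K c c0 cK.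
  by move=> _ [n [a ->]] /=; exact: bnd.
exists f; split => // j.
have Kj : K (v j, s j).
  exists j.+1, (fun i => (i == j)%:R); congr (_, _).
    rewrite (bigD1 (@ord_max j))//= eqxx scale1r big1 ?addr0// => i.
    by rewrite -val_eqE /= => /negbTE ->; rewrite scale0r.
  rewrite (bigD1 (@ord_max j))//= eqxx mul1r big1 ?addr0// => i.
  by rewrite -val_eqE /= => /negbTE ->; rewrite mul0r.
exact: (fK _ Kj (KN _ Kj)).
Qed.

End integer_combinations.

Section disintegration.
Context {R : realType} d {T : measurableType d}.
Context {mu : {sigma_finite_measure set T -> \bar R}} (E : koetheSpace mu).
Context (X : normedModType R).
Hypothesis E_MLUR : MLUR E.

Local Notation kfun := (@koethe_fun R d T mu E).

Definition int_comb (z : nat -> koetheBochner E X) (a : seq int) :=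
  \sum_(i < size a) ((a`_i)%:~R : R) *: z i.

Lemma kbfun_sum n (c : nat -> R) (z : nat -> koetheBochner E X) :
  \forall t \ae mu, kbfun (\sum_(i < n) c i *: z i) t =
    \sum_(i < n) c i *: kbfun (z i) t.
Proof.
elim: n => [|n ih].
  by rewrite big_ord0; apply: filterS (@kbfun0E _ _ _ _ E X) => t ->;
    rewrite big_ord0.
rewrite big_ord_recr; apply: filterS3 ih (kbfunZE (c n) (z n))
  (kbfunDE (\sum_(i < n) c i *: z i) (c n *: z n)) => t ih zt -> /=.
by rewrite big_ord_recr ih zt.
Qed.

Lemma density_sum (F : koetheBochner E X -> R) n (c : nat -> R)
    (z : nat -> koetheBochner E X) (phi : nat -> T -> R) : scalar F ->
  (forall i, density F (z i) (phi i)) ->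
  density F (\sum_(i < n) c i *: z i) (fun t => \sum_(i < n) c i * phi i t).
Proof.
move=> lF dz; elim: n => [|n ih].
  rewrite big_ord0 -(scale0r (z 0%N)).
  by apply: density_ext (densityZ lF 0 (dz 0%N)) => t; rewrite big_ord0 mul0r.
rewrite big_ord_recr;
  apply: density_ext (densityD lF ih (densityZ lF (c n) (dz n))).
by move=> t; rewrite big_ord_recr.
Qed.

(** The vector [y] whose value under [F] is the integral of [`|phi|] over the
    zero set of [z] is zero. *)
Lemma density_eq0 (F : koetheBochner E X -> R) z phi : scalar F ->
  density F z phi ->
  \forall t \ae mu, kbfun z t = 0 -> phi t = 0.
Proof.
move=> lF dz; have mphi := density_measurable dz.
pose A := [set t | kfun (kbnorm z) t = 0].
have mA : measurable A.
  rewrite /A -[X in measurable X]setTI.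
  by have /(_ measurableT _ (measurable_set1 (0 : R))) :=
    measurable_koethe_fun (kbnorm z).
have [y yE Fy] := density_abs lF mA dz.
have y0 : y = 0.
  apply: kbfun_eq; apply: filterS3 yE (kbnormE z) (@kbfun0E _ _ _ _ E X).
  move=> t yt zt ->; apply/eqP; rewrite -normr_eq0 yt indicE.
  have [/set_mem|_] := boolP (t \in A); last by rewrite mul0r.
  by rewrite /A /= zt => ->; rewrite mulr0.
have : (\int[mu]_(t in A) `|(EFin \o phi) t| = 0)%E.
  by rewrite -[RHS](_ : (F y)%:E = _)// y0 scalar0.
move/(ae_eq_integral_abs _ mA); rewrite (_ : measurable_fun _ _ = True);
  last first.
  by apply/propext; split => // _; exact/measurable_EFinP/measurable_funTS.
move=> /(_ Logic.I); apply: filterS2 (kbnormE z) => t zt h z0.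
have : A t by rewrite /A /= zt z0 normr0.
by move/h => /= [].
Qed.

(** Almost everywhere the integer combinations of the [z i] satisfy the bound of
    [functional_of_int_comb]: where such a combination is nonzero because the
    weight [rho] dominates the quotient of its density by its norm, and where
    it is zero because its density is zero by [density_eq0]. *)
Lemma functional_disintegration (F : koetheBochner E X -> R)
    (z : nat -> koetheBochner E X) :
  scalar F -> (forall x, `|F x| <= `|x|) ->
  exists (rho : T -> R) (phi : nat -> T -> R) (G : T -> X -> R),
  [/\ [/\ measurable_fun setT rho, forall t, 0 <= rho t &
        forall e, (\int[mu]_t (rho t * `|kfun e t|)%:E <= `|e|%:E)%E],
      forall i, density F (z i) (phi i),
      forall t, scalar (G t) /\ (forall x, `|G t x| <= rho t * `|x|) &
      \forall t \ae mu, forall i, G t (kbfun (z i) t) = phi i t].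
Proof.
move=> lF Fle.
have /choice[phi dphi] : forall i, exists phi, density F (z i) phi.
  by move=> i; exact: density_exists.
pose cf (q : nat) : seq int := odflt [::] (unpickle q).
pose phic (a : seq int) t := \sum_(i < size a) (a`_i)%:~R * phi i t.
have dc a : density F (int_comb z a) (phic a).
  exact: (density_sum _ (fun i => (a`_i)%:~R) lF dphi).
have [rho [mrho rho0 rho_ge rho_int]] := admissible_sup lF Fle
  (fun q => admissible_density lF Fle (dc (cf q))).
have bnd : \forall t \ae mu, int_comb_bounded (fun i => kbfun (z i) t)
    (fun i => phi i t) (rho t).
  have h : \forall t \ae mu, forall q,
      [/\ kfun (kbnorm (int_comb z (cf q))) t = `|kbfun (int_comb z (cf q)) t|,
          kbfun (int_comb z (cf q)) t =
            \sum_(i < size (cf q)) ((cf q)`_i)%:~R *: kbfun (z i) t &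
          kbfun (int_comb z (cf q)) t = 0 -> phic (cf q) t = 0].
    apply: ae_foralln => q; apply: filterS3 (kbnormE (int_comb z (cf q)))
      (kbfun_sum (size (cf q)) (fun i => ((cf q)`_i)%:~R) z)
      (density_eq0 lF (dc (cf q))).
    by move=> t ? ? ?; split.
  apply: filterS2 rho_ge h => t rho_ge h a.
  have [] := h (pickle a); have := rho_ge (pickle a).
  rewrite /cf pickleK /= => + nE zE z0; rewrite nE normr_id -zE.
  rewrite -[\sum_(i < size a) _]/(phic a t).
  have [/z0 ->|znz] := eqVneq (kbfun (int_comb z a) t) 0.
    by rewrite normr0 mulr_ge0.
  by rewrite ler_pdivrMr// normr_gt0.
have /choice[G hG] : forall t, exists g : X -> R,
    [/\ scalar g, forall x, `|g x| <= rho t * `|x| &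
     int_comb_bounded (fun i => kbfun (z i) t) (fun i => phi i t) (rho t) ->
     forall i, g (kbfun (z i) t) = phi i t].
  move=> t; have [/(functional_of_int_comb (rho0 t))[g [lg gle gE]]|nb] :=
    pselect (int_comb_bounded (fun i => kbfun (z i) t) (fun i =>
      phi i t) (rho t)).
    by exists g; split.
  exists (fun=> 0); split => //.
    by move=> a x y; rewrite mulr0 addr0.
  by move=> x; rewrite normr0 mulr_ge0.
exists rho, phi, G; split => //.
  by move=> t; have [] := hG t.
by apply: filterS bnd => t bt; have [_ _] := hG t; exact.
Qed.

End disintegration.

(** * Almost everywhere convergence and the pointwise alternative *)

Section summable_L1.
Context {R : realType} d {T : measurableType d} {mu : {measure set T ->
  \bar R}}.

(** The sum of the series is integrable by monotone convergence; it bounds all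
    partial sums at once and makes the series converge almost everywhere. *)
Lemma summable_L1_dominated (u : nat -> T -> R) :
  (forall n, measurable_fun setT (u n)) -> (forall n t, 0 <= u n t) ->
  (forall n, (\int[mu]_t (u n t)%:E <= (2^-1 ^+ n.+1)%:E)%E) ->
  exists h : T -> R, mu.-integrable setT (EFin \o h) /\
    \forall t \ae mu, forall n, series (u ^~ t) n <= h t.
Proof.
move=> mu_ u0 intu; pose S t := (\sum_(0 <= n <oo) (u n t)%:E)%E.
have S0 t : (0 <= S t)%E by apply: nneseries_ge0 => n _ _; rewrite lee_fin.
have mS : measurable_fun setT S.
  by apply: ge0_emeasurable_sum => n; [move=> t _ _;
    rewrite lee_fin | move=> _; exact/measurable_EFinP].
have intS : (\int[mu]_t S t <= 1%:E)%E.
  rewrite integral_nneseries//; last 2 first.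
  - by move=> n; exact/measurable_EFinP/mu_.
  - by move=> n t _; rewrite lee_fin.
  have -> : 1%:E = (\sum_(0 <= n <oo) (1 / (2 ^ (n + 1))%:R)%:E)%E :> \bar R.
    by apply/esym/cvg_lim => //; have := @cvg_geometric_eseries_half R 1 0;
      rewrite expr0 divr1.
  apply: lee_nneseries => [n _ _|n _]; first by apply: integral_ge0 => t _;
    rewrite lee_fin.
  by rewrite addn1 natrX div1r -exprVn.
have iS : mu.-integrable setT S.
  apply/integrableP; split => //; under eq_integral do rewrite gee0_abs//.
  by apply: le_lt_trans intS _; exact: ltry.
exists (fine \o S); split.
  apply: le_integrable iS => //.
    by apply/measurable_EFinP; exact: measurableT_comp.
  move=> t _; rewrite [leRHS]gee0_abs//= ger0_norm ?fine_ge0//.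
  by case: (S t) (S0 t) => //= *; rewrite ?leey.
have := integrable_ae measurableT iS; apply: filterS => t /(_ Logic.I) St n.
rewrite -lee_fin /= fineK// /series /= -sumEFin.
by apply: nneseries_lim_ge => k _; rewrite lee_fin.
Qed.

Lemma nondecreasing_bounded_cvg_series (v : R^nat) (c : R) : (forall n,
  0 <= v n) ->
  (forall n, series v n <= c) -> cvgn (series v).
Proof.
move=> v0 vc; apply: nondecreasing_is_cvgn; last first.
  by exists c => _ [n _ <-].
by apply/nondecreasing_seqP => n; rewrite seriesSr lerDl.
Qed.

Lemma summable_increments_cvg (v w : R^nat) :
  (forall n, `|v n.+1 - v n| <= w n) -> cvgn (series w) ->
  cvgn v /\ forall n c, (forall m, series w m <= c) -> v n <= v 0%N + c.
Proof.
move=> vw cw; have vE n : series (fun k => v k.+1 - v k) n = v n - v 0%N.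
  by rewrite /series /= telescope_sumr.
split=> [|n c wc].
  have : cvgn (series (fun k => v k.+1 - v k)).
    apply: normed_cvg; apply: (series_le_cvg _ _ vw cw) => // n.
    exact: le_trans (normr_ge0 _) (vw n).
  rewrite (_ : series _ = fun n => v n - v 0%N); last exact/funext.
  move=> h; rewrite (_ : v = (fun n => (v n - v 0%N) + v 0%N)).
    by apply: is_cvgD => //; exact: is_cvg_cst.
  by apply/funext => n; rewrite subrK.
rewrite -lerBlDl -vE; apply: le_trans (wc n).
by apply: ler_sum => k _; exact: le_trans (ler_norm _) (vw k).
Qed.

End summable_L1.

Section pointwise_alternative.
Context {R : realType} (V : normedModType R).

(** If [kappa] is zero, [r n * `|y_ n|] tends to zero and controls both terms.
    If [kappa] is positive, [x] is nonzero and [r n] converges to the positive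
    number [kappa / `|x|], so that the weights can be divided out and
    [alternative_scaled] applies. *)
Lemma weighted_alternative (C : set ((V -> R)^nat)) (x_ y_ : V^nat) (x : V)
    (g : (V -> R)^nat) (r : R^nat) (kappa : R) :
  termwise_stable C -> midpoint_alternative C -> C g ->
  (forall n, scalar (g n)) -> (forall n z, `|g n z| <= r n * `|z|) ->
  (forall n, 0 <= r n) ->
  r n * `|x| @[n --> \oo] --> kappa ->
  r n * `| `|x_ n| - `|x| | @[n --> \oo] --> (0 : R) ->
  r n * `| `|y_ n| - `|x| | @[n --> \oo] --> (0 : R) ->
  r n * `|x - 2^-1 *: (x_ n + y_ n)| @[n --> \oo] --> (0 : R) ->
  r n * `|x_ n| - g n (x_ n) @[n --> \oo] --> (0 : R) ->
  r n * `|y_ n| - g n (y_ n) @[n --> \oo] --> (0 : R).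
Proof.
move=> sC altC Cg lg gr r0 rx xx yx mid gx.
have kappa0 : 0 <= kappa.
  by rewrite -(cvg_lim _ rx)//; apply: limr_ge;
    [exact: cvgP rx|apply: nearW => n; rewrite mulr_ge0].
move: kappa0; rewrite le_eqVlt => /predU1P[k0|k0].
  have h : 2 * (r n * `|x| + r n * `| `|y_ n| - `|x| |) @[n --> \oo] -->
      (2 * (kappa + 0) : R).
    by apply: cvgM; [exact: cvg_cst|exact: cvgD].
  rewrite -k0 addr0 mulr0 in h; apply: cvg_dist_le h; apply: nearW => n.
  rewrite subr0; apply: le_trans (ler_normB _ _) _.
    rewrite normrM normr_id (ger0_norm (r0 n)).
    have := gr n (y_ n); rewrite -mulrDr.
    have : r n * `|y_ n| <= r n * (`|x| + `| `|y_ n| - `|x| |).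
      by rewrite ler_wpM2l// -lerBlDl ler_norm.
    lra.
have x0 : x != 0.
  apply/eqP => x0; rewrite x0 normr0 in rx.
  move: rx; under eq_fun do rewrite mulr0.
  by move=> /cvg_lim; rewrite lim_cst// => /(_ _)/esym k00;
    rewrite k00 ?ltxx in k0.
have nx : 0 < `|x| by rewrite normr_gt0.
have rcvg : r n @[n --> \oo] --> kappa / `|x|.
  have -> : r = (fun n => r n * `|x| / `|x|).
    by apply/funext => n; rewrite mulfK// gt_eqF.
  by apply: cvgM => //; exact: cvg_cst.
have k'0 : 0 < kappa / `|x| by rewrite divr_gt0.
have weight (z : R^nat) : r n * z n @[n --> \oo] --> (0 : R) ->
  z n @[n --> \oo] --> (0 : R).
  move=> rz; have h : (r n)^-1 * (r n * z n) @[n --> \oo] --> (kappa / `|x|)^-1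
    * 0.
    by apply: cvgM => //; apply: cvgV => //; rewrite gt_eqF.
  rewrite mulr0 in h; apply: cvg_trans h; apply: near_eq_cvg; near=> n.
  have rn0 : 0 < r n by near: n; exact: (cvgr_gt _ rcvg).
  by rewrite mulKf// gt_eqF.
have xxn : `|x_ n| @[n --> \oo] --> `|x| by apply: cvg_normB; exact: weight.
have yxn : `|y_ n| @[n --> \oo] --> `|x| by apply: cvg_normB; exact: weight.
have gxn : g n (x_ n) @[n --> \oo] --> kappa / `|x| * `|x|.
  have -> : (fun n => g n (x_ n)) =
    (fun n => r n * `|x_ n| - (r n * `|x_ n| - g n (x_ n))).
    by apply/funext => n; rewrite subKr.
  by rewrite -[X in _ --> X]subr0; apply: cvgB => //; exact: cvgM.
have gyn : g n (y_ n) @[n --> \oo] --> kappa / `|x| * `|x|.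
  exact: (alternative_scaled sC altC Cg lg gr rcvg k'0 x0 xxn yxn (weight _ mid)
    gxn).
by rewrite -(subrr (kappa / `|x| * `|x|)); apply: cvgB => //; exact: cvgM.
Unshelve. all: by end_near. Qed.

End pointwise_alternative.

(** * Integration of the pointwise alternative *)

Section weights.
Context {R : realType} d {T : measurableType d}.
Context {mu : {sigma_finite_measure set T -> \bar R}} (E : koetheSpace mu).
Context (X : normedModType R).
Local Notation kfun := (@koethe_fun R d T mu E).
Implicit Types (e : E) (rho : T -> R).

Definition koethe_weight rho := [/\ measurable_fun setT rho, forall t,
  0 <= rho t &
  forall e, (\int[mu]_t (rho t * `|kfun e t|)%:E <= `|e|%:E)%E].

Definition weight_pairing rho e := fine (\int[mu]_t (rho t * `|kfun e t|)%:E)%E.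

Variable rho : T -> R.
Hypothesis rhoP : koethe_weight rho.

Lemma weight_integrable e : mu.-integrable setT (fun t =>
  (rho t * `|kfun e t|)%:E).
Proof.
case: rhoP => mrho rho0 rho_int; apply/integrableP; split.
  exact/measurable_EFinP/measurable_weight.
under eq_integral do rewrite gee0_abs ?lee_fin ?mulr_ge0//.
by apply: le_lt_trans (rho_int e) _; exact: ltry.
Qed.

Lemma weight_pairingE e :
  (\int[mu]_t (rho t * `|kfun e t|)%:E)%E = (weight_pairing rho e)%:E.
Proof. by rewrite fineK//; apply: integrable_fin_num => //;
  exact: weight_integrable. Qed.

Lemma weight_pairing_le e : weight_pairing rho e <= `|e|.
Proof. by rewrite -lee_fin -weight_pairingE; case: rhoP. Qed.

Lemma weight_pairing_lip (e e' : E) :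
  weight_pairing rho e <= weight_pairing rho e' + `|e - e'|.
Proof.
apply: (@le_trans _ _ (weight_pairing rho e' + weight_pairing rho (e - e'))).
  rewrite -lee_fin EFinD -!weight_pairingE -integralD//; last 2 first.
  - exact: weight_integrable.
  - exact: weight_integrable.
  apply: ae_ge0_le_integral => //.
  - by move=> t _; case: rhoP => _ rho0 _; rewrite lee_fin mulr_ge0.
  - by have /measurable_int := weight_integrable e.
  - by move=> t _; case: rhoP => _ rho0 _;
      rewrite -EFinD lee_fin addr_ge0// mulr_ge0.
  - by apply: emeasurable_funD; [have /measurable_int := weight_integrable e'|
      have /measurable_int := weight_integrable (e - e')].
  apply: filterS (koethe_funBE e e') => t -> _; rewrite -EFinD lee_fin -mulrDr.
  case: rhoP => _ rho0 _; rewrite ler_wpM2l//.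
  by have := ler_normD (kfun e' t) (kfun e t - kfun e' t); rewrite addrC subrK.
by rewrite lerD2l; exact: weight_pairing_le.
Qed.

(** The integrand of [weight_pairing rho (kbnorm x) - F x] is nonnegative, so
    that this difference measures the defect in L1. *)
Lemma density_defect (F : koetheBochner E X -> R) (G : T -> X -> R)
    (x : koetheBochner E X) (phi : T -> R) :
  (forall t v, `|G t v| <= rho t * `|v|) -> density F x phi ->
  (\forall t \ae mu, G t (kbfun x t) = phi t) ->
  (\int[mu]_t `|rho t * `|kfun (kbnorm x) t| - phi t|%:E)%E =
    (weight_pairing rho (kbnorm x) - F x)%:E.
Proof.
move=> Gle dx Gphi; have mphi := density_measurable dx;
  case: (rhoP) => mrho rho0 _.
have mw := measurable_weight (kbnorm x) mrho.
rewrite EFinB -weight_pairingE -[X in F X](kb_restrT x) dx.2//.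
rewrite -integralB_EFin//; last 2 first.
- exact: weight_integrable.
- exact: dx.1.
apply: ae_eq_integral => //.
- apply/measurable_EFinP; apply: measurableT_comp => //; exact: measurable_funB.
- exact: ((measurable_EFinP _ _).2 (measurable_funB mw mphi)).
apply: filterS2 Gphi (kbnormE x) => t Gt xt _;
  rewrite -EFinB ger0_norm// subr_ge0.
by rewrite -Gt xt normr_id; apply: le_trans (ler_norm _) (Gle t _).
Qed.

Lemma density_defect_ge0 (F : koetheBochner E X -> R) (G : T -> X -> R)
    (x : koetheBochner E X) (phi : T -> R) :
  (forall t v, `|G t v| <= rho t * `|v|) -> density F x phi ->
  (\forall t \ae mu, G t (kbfun x t) = phi t) ->
  F x <= weight_pairing rho (kbnorm x).
Proof.
move=> Gle dx Gphi; rewrite -subr_ge0 -lee_fin -(density_defect Gle dx Gphi).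
by apply: integral_ge0 => t _; rewrite lee_fin.
Qed.

End weights.

Section convergence.
Context {R : realType} d {T : measurableType d}.
Context {mu : {sigma_finite_measure set T -> \bar R}} (E : koetheSpace mu).
Context (X : normedModType R).
Hypothesis E_MLUR : MLUR E.
Local Notation kfun := (@koethe_fun R d T mu E).

(** The triangle inequality in [X] bounds [`|x|] pointwise by the mean of
    [`|x_ n|] and [`|y_ n|] plus the norm of the midpoint error. *)
Lemma MLUR_kbnorm_cvg (x_ y_ : nat ->
  koetheBochner E X) (x : koetheBochner E X) :
  (forall n, `|x_ n| = 1) -> (forall n, `|y_ n| = 1) -> `|x| = 1 ->
  `|x - 2^-1 *: (x_ n + y_ n)| @[n --> \oo] --> (0 : R) ->
  `|kbnorm (x_ n) - kbnorm x| @[n --> \oo] --> (0 : R) /\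
  `|kbnorm (y_ n) - kbnorm x| @[n --> \oo] --> (0 : R).
Proof.
move=> x1 y1 x01 mid.
apply: (MLUR_koethe_average E_MLUR
  (r := fun n => kbnorm (x - 2^-1 *: (x_ n + y_ n)))).
- by rewrite norm_kbnorm.
- by move=> n; rewrite norm_kbnorm.
- by move=> n; rewrite norm_kbnorm.
- exact: kbnorm_ge0.
- by move=> n; exact: kbnorm_ge0.
- by move=> n; exact: kbnorm_ge0.
- by move=> n; exact: kbnorm_ge0.
- move=> n; apply: filterS3 (filterI (kbnormE x) (kbnormE (x - 2^-1 *: (x_ n +
    y_ n))))
    (filterI (kbnormE (x_ n)) (kbnormE (y_ n)))
    (filterI (kbfunBE x (2^-1 *: (x_ n + y_ n)))
      (filterI (kbfunZE 2^-1 (x_ n + y_ n)) (kbfunDE (x_ n) (y_ n)))).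
  move=> t [-> ->] [-> ->] [-> [-> ->]].
  set u := kbfun x t; set v := kbfun (x_ n) t; set w := kbfun (y_ n) t.
  have := ler_normD (u - 2^-1 *: (v + w)) (2^-1 *: (v + w)).
  rewrite subrK normrZ gtr0_norm; last by lra.
  have := ler_normD v w; lra.
- by under eq_fun do rewrite norm_kbnorm.
Qed.

Variables (C : set ((X -> R)^nat)).
Hypotheses (C_termwise : termwise_stable C) (C_subseq : subseq_stable C).
Hypothesis altC : midpoint_alternative C.

Variables (x_ y_ : nat -> koetheBochner E X) (x : koetheBochner E X).
Hypotheses (x1 : forall n, `|x_ n| = 1) (y1 : forall n,
  `|y_ n| = 1) (x01 : `|x| = 1).
Hypothesis mid : `|x - 2^-1 *: (x_ n + y_ n)| @[n --> \oo] --> (0 : R).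
Variables (F : nat -> koetheBochner E X -> R) (rho : nat -> T -> R).
Variables (G : nat -> T -> X -> R) (phi psi : nat -> T -> R).
Hypothesis rhoP : forall n, koethe_weight E (rho n).
Hypothesis G_scalar : forall n t, scalar (G n t).
Hypothesis G_le : forall n t v, `|G n t v| <= rho n t * `|v|.
Hypothesis CG : forall t, C (fun n => G n t).
Hypothesis dx : forall n, density (F n) (x_ n) (phi n).
Hypothesis dy : forall n, density (F n) (y_ n) (psi n).
Hypothesis Gx : forall n, \forall t \ae mu, G n t (kbfun (x_ n) t) = phi n t.
Hypothesis Gy : forall n, \forall t \ae mu, G n t (kbfun (y_ n) t) = psi n t.
Hypothesis rho_cauchy : forall c : R, 0 < c -> exists N, forall n m,
  (N <= n)%N -> (n <= m)%N ->
  (\int[mu]_t (`|rho m t - rho n t| * `|kfun (kbnorm x) t|)%:E <= c%:E)%E.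
Hypothesis Fx : F n (x_ n) @[n --> \oo] --> (1 : R).

Let a := kbnorm x.
Let A n := kbnorm (x_ n).
Let B n := kbnorm (y_ n).
Let r n := kbnorm (x - 2^-1 *: (x_ n + y_ n)).
Let w n t := rho n t * `|kfun (A n - a) t| + rho n t * `|kfun (B n - a) t| +
  rho n t * `|kfun (r n) t| + `|rho n t * `|kfun (A n) t| - phi n t|.
Let v n m t := `|rho m t - rho n t| * `|kfun a t|.

Let mrho n : measurable_fun setT (rho n). Proof. by case: (rhoP n). Qed.
Let rho0 n t : 0 <= rho n t. Proof. by case: (rhoP n). Qed.

Let mdefect n : measurable_fun setT (fun t =>
  `|rho n t * `|kfun (A n) t| - phi n t|).
Proof.
apply: measurableT_comp => //; apply: measurable_funB;
  first exact: measurable_weight.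
exact: density_measurable (dx n).
Qed.

Let mw n : measurable_fun setT (w n).
Proof.
by apply: measurable_funD => //; apply: measurable_funD;
  [apply: measurable_funD|]; exact: measurable_weight.
Qed.

Let w0 n t : 0 <= w n t.
Proof. by rewrite !addr_ge0// mulr_ge0. Qed.

Let mv n m : measurable_fun setT (v n m).
Proof.
apply: measurable_weight; apply: measurableT_comp => //.
exact: measurable_funB.
Qed.

Let eps n := `|A n - a| + `|B n - a| + `|x - 2^-1 *: (x_ n + y_ n)| +
  (1 - F n (x_ n)).

Let int_w n : (\int[mu]_t (w n t)%:E <= (eps n)%:E)%E.
Proof.
have mW e : measurable_fun setT (fun t => (rho n t * `|kfun e t|)%:E).
  by apply/measurable_EFinP; exact: measurable_weight.
have W0 e t : (0 <= (rho n t * `|kfun e t|)%:E)%E by rewrite lee_fin mulr_ge0.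
rewrite (eq_integral (fun t => (rho n t * `|kfun (A n - a) t|)%:E +
  (rho n t * `|kfun (B n - a) t|)%:E + (rho n t * `|kfun (r n) t|)%:E +
  `|rho n t * `|kfun (A n) t| - phi n t|%:E)%E)//.
rewrite ge0_integralD//; last 3 first.
- by move=> t _; rewrite !adde_ge0.
- by do 2 (apply: emeasurable_funD => //).
- exact/measurable_EFinP.
rewrite ge0_integralD//; last 2 first.
- by move=> t _; rewrite !adde_ge0.
- exact: emeasurable_funD.
rewrite ge0_integralD// (density_defect (rhoP n) (@G_le n) (dx n) (Gx n)).
rewrite /eps !EFinD; apply: leeD; last first.
  by rewrite -EFinB lee_fin lerB// -(x1 n) -(norm_kbnorm (x_ n))
    weight_pairing_le.
by apply: leeD; [apply: leeD|rewrite -norm_kbnorm]; case: (rhoP n).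
Qed.

Let eps0 : eps n @[n --> \oo] --> (0 : R).
Proof.
have [Acvg Bcvg] := MLUR_kbnorm_cvg x1 y1 x01 mid.
rewrite [X in _ --> X](_ : 0 = 0 + 0 + 0 + (1 - 1));
  last by rewrite subrr !addr0.
apply: cvgD; last by apply: cvgB => //; exact: cvg_cst.
by apply: cvgD => //; exact: cvgD.
Qed.

(** All the quantities that have to tend to zero pointwise, weighted by [rho n],
    are collected in the nonnegative function [w n], whose integral tends to
    zero.  Along a fast subsequence the [w n] and the increments of
    [rho n * `|x|] are summable almost everywhere, with an integrable sum which
    also dominates the defect of [y_ n].  That defect tends to zero pointwise by
    [weighted_alternative]. *)
Lemma convergence_along_subseq : exists2 k : nat -> nat,
  {homo k : m n / (m < n)%N} & F (k n) (y_ (k n)) @[n --> \oo] --> (1 : R).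
Proof.
(* Two integrals bounded by q i add up to the bound 2^-1 ^+ i.+1 of
   summable_L1_dominated. *)
pose q i : R := 2^-1 ^+ i.+2.
have q0 i : 0 < q i by rewrite exprn_gt0// invr_gt0.
pose P i n := (\int[mu]_t (w n t)%:E <= (q i)%:E)%E /\
  forall m, (n <= m)%N -> (\int[mu]_t (v n m t)%:E <= (q i)%:E)%E.
have [i N0|k hk Pk] := @frequently_subseq P.
  have [N1 N1P] := rho_cauchy (q0 i).
  have [N2 _ N2P] := cvgr_lt _ eps0 _ (q0 i).
  exists (maxn N0 (maxn N1 N2)); first exact: leq_maxl.
  split; last first.
    by move=> m nm; apply: N1P => //; rewrite !leq_max leqnn orbT.
  apply: le_trans (int_w _) _; rewrite lee_fin ltW//; apply: N2P => /=.
  by rewrite !leq_max leqnn !orbT.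
exists k => //.
pose u i t := w (k i) t + v (k i) (k i.+1) t.
have u0 i t : 0 <= u i t by rewrite addr_ge0// mulr_ge0.
have mu_ i : measurable_fun setT (u i) by exact: measurable_funD.
have [i|h [ih hP]] := @summable_L1_dominated _ _ _ mu u mu_ u0.
  rewrite (eq_integral (fun t => (w (k i) t)%:E + (v (k i) (k i.+1) t)%:E)%E)//.
  rewrite ge0_integralD//; last 4 first.
  - by move=> t _; rewrite lee_fin.
  - exact/measurable_EFinP.
  - by move=> t _; rewrite lee_fin mulr_ge0.
  - exact/measurable_EFinP.
  have [wk vk] := Pk i;
    apply: le_trans (leeD wk (vk _ (ltnW (hk _ _ (ltnSn i))))) _.
  by rewrite -EFinD lee_fin /q [X in X + _]exprS [X in _ + X]exprS -mulrDl; lra.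
pose U i t := `|rho (k i) t * `|kfun (B (k i)) t| - psi (k i) t|.
have mU i : measurable_fun setT (U i).
  apply: measurableT_comp => //; apply: measurable_funB;
    first exact: measurable_weight.
  exact: density_measurable (dy (k i)).
pose dom t := 2 * (rho (k 0%N) t * `|kfun a t| + h t + h t).
have idom : mu.-integrable setT (EFin \o dom).
  rewrite (_ : EFin \o dom =
    fun t => (2%:E * (((rho (k 0%N) t * `|kfun a t|)%:E +
    (EFin \o h) t) + (EFin \o h) t))%E)//.
  apply: integrableZl => //; apply: integrableD => //; apply: integrableD => //.
  exact: weight_integrable.
have pointwise : \forall t \ae mu, U i t @[i --> \oo] --> (0 : R) /\
    forall i, U i t <= dom t.
  have facts : \forall t \ae mu, forall n,
     [/\ [/\ kfun (A n - a) t = kfun (A n) t - kfun a t,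
         kfun (B n - a) t = kfun (B n) t - kfun a t & kfun (A n) t =
           `|kbfun (x_ n) t|],
         [/\ kfun (B n) t = `|kbfun (y_ n) t|, kfun a t = `|kbfun x t| &
         kfun (r n) t = `|kbfun x t - 2^-1 *: (kbfun (x_ n) t +
           kbfun (y_ n) t)|],
         G n t (kbfun (x_ n) t) = phi n t & G n t (kbfun (y_ n) t) = psi n t].
    apply: ae_foralln => n; apply: filterS3
      (filterI (filterI (koethe_funBE (A n) a) (koethe_funBE (B n) a))
        (filterI (kbnormE (x_ n)) (kbnormE (y_ n))))
      (filterI (filterI (kbnormE x) (kbnormE (x - 2^-1 *: (x_ n + y_ n))))
        (filterI (Gx n) (Gy n)))
      (filterI (kbfunBE x (2^-1 *: (x_ n + y_ n)))
        (filterI (kbfunZE 2^-1 (x_ n + y_ n)) (kbfunDE (x_ n) (y_ n)))).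
    move=> t [[? ?] [? ?]] [[? rt] [? ?]] [b1 [b2 b3]]; split=> //; split => //.
    by rewrite rt b1 b2 b3.
  apply: filterS2 hP facts => t ht facts.
  have cu : cvgn (series (u ^~ t)).
    exact: (nondecreasing_bounded_cvg_series (fun n => u0 n t) ht).
  have ucvg0 : u i t @[i --> \oo] --> (0 : R) := cvg_series_cvg_0 cu.
  have u_h i : u i t <= h t.
    apply: le_trans (ht i.+1); rewrite seriesSr lerDr; exact: sumr_ge0.
  pose b i := rho (k i) t * `|kfun a t|.
  have [bcvg ble] : cvgn b /\ forall n c, (forall m, series (u^~ t) m <= c) ->
      b n <= b 0%N + c.
    apply: summable_increments_cvg => // n.
    rewrite /b -mulrBl normrM normr_id;
      apply: le_trans (_ : v (k n) (k n.+1) t <= _) => //.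
    by rewrite lerDr.
  have small (z : nat -> R) : (forall i,
    0 <= z i <= u i t) -> z i @[i --> \oo] --> (0 : R).
    move=> zu; apply: cvg_dist_le ucvg0; apply: nearW => i.
    by have /andP[z0 zle] := zu i; rewrite subr0 ger0_norm.
  have kx : kfun a t = `|kbfun x t| by have [_ []] := facts 0%N.
  split.
    have -> : (fun i => U i t) =
      (fun i => `|rho (k i) t * `|kbfun (y_ (k i)) t| -
        G (k i) t (kbfun (y_ (k i)) t)|).
      apply/funext => i; have [_ [Bt _ _] _ Gyt] := facts (k i).
      by rewrite /U Bt normr_id Gyt.
    rewrite -(normr0 R); apply: cvg_norm.
    apply: (weighted_alternative C_termwise altC (x_ := fun i =>
      kbfun (x_ (k i)) t)
      (x := kbfun x t) (kappa := limn b) (C_subseq k (CG t)) _ _ _ _).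
    - by [].
    - by [].
    - by [].
    - by move: bcvg; rewrite /b kx normr_id.
    - apply: small => i; rewrite mulr_ge0//=.
      have [[Aat _ At] [_ _ _] _ _] := facts (k i).
      rewrite -At -kx -Aat /u /w.
      have := mulr_ge0 (rho0 (k i) t) (normr_ge0 (kfun (B (k i) - a) t)).
      have := mulr_ge0 (rho0 (k i) t) (normr_ge0 (kfun (r (k i)) t)).
      have := normr_ge0 (rho (k i) t * `|kfun (A (k i)) t| - phi (k i) t).
      have : 0 <= v (k i) (k i.+1) t by rewrite mulr_ge0.
      lra.
    - apply: small => i; rewrite mulr_ge0//=.
      have [[_ Bat _] [Bt _ _] _ _] := facts (k i).
      rewrite -Bt -kx -Bat /u /w.
      have := mulr_ge0 (rho0 (k i) t) (normr_ge0 (kfun (A (k i) - a) t)).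
      have := mulr_ge0 (rho0 (k i) t) (normr_ge0 (kfun (r (k i)) t)).
      have := normr_ge0 (rho (k i) t * `|kfun (A (k i)) t| - phi (k i) t).
      have : 0 <= v (k i) (k i.+1) t by rewrite mulr_ge0.
      lra.
    - apply: small => i; rewrite mulr_ge0//=.
      have [_ [_ _ rt] _ _] := facts (k i).
      rewrite -[X in _ * X]normr_id -rt /u /w.
      have := mulr_ge0 (rho0 (k i) t) (normr_ge0 (kfun (A (k i) - a) t)).
      have := mulr_ge0 (rho0 (k i) t) (normr_ge0 (kfun (B (k i) - a) t)).
      have := normr_ge0 (rho (k i) t * `|kfun (A (k i)) t| - phi (k i) t).
      have : 0 <= v (k i) (k i.+1) t by rewrite mulr_ge0.
      lra.
    - apply: small => i; have [[_ _ At] _ Gt _] := facts (k i).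
      have le := le_trans (ler_norm _) (G_le (k i) t (kbfun (x_ (k i)) t)).
      rewrite subr_ge0 le /= Gt -At -[kfun (A (k i)) t]ger0_norm;
        last by rewrite At.
      have := mulr_ge0 (rho0 (k i) t) (normr_ge0 (kfun (A (k i) - a) t)).
      have := mulr_ge0 (rho0 (k i) t) (normr_ge0 (kfun (B (k i) - a) t)).
      have := mulr_ge0 (rho0 (k i) t) (normr_ge0 (kfun (r (k i)) t)).
      have := ler_norm (rho (k i) t * `|kfun (A (k i)) t| - phi (k i) t).
      have : 0 <= v (k i) (k i.+1) t by rewrite mulr_ge0.
      rewrite /u /w; lra.
  move=> i; have [[_ Bat _] [Bt _ _] _ Gyt] := facts (k i).
  have := ler_normB (rho (k i) t * `|kfun (B (k i)) t|) (psi (k i) t).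
  rewrite -/(U i t) normrM normr_id (ger0_norm (rho0 _ _)).
  have : `|psi (k i) t| <= rho (k i) t * `|kfun (B (k i)) t|.
    by rewrite -Gyt Bt normr_id.
  have : rho (k i) t * `|kfun (B (k i)) t| <=
      rho (k i) t * `|kfun a t| + rho (k i) t * `|kfun (B (k i) - a) t|.
    rewrite -mulrDr ler_wpM2l// Bat.
    by have := ler_normD (kfun a t) (kfun (B (k i)) t - kfun a t);
      rewrite addrC subrK.
  have : rho (k i) t * `|kfun (B (k i) - a) t| <= u i t.
    have := mulr_ge0 (rho0 (k i) t) (normr_ge0 (kfun (A (k i) - a) t)).
    have := mulr_ge0 (rho0 (k i) t) (normr_ge0 (kfun (r (k i)) t)).
    have := normr_ge0 (rho (k i) t * `|kfun (A (k i)) t| - phi (k i) t).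
    have : 0 <= v (k i) (k i.+1) t by rewrite mulr_ge0.
    rewrite /u /w; lra.
  have := u_h i; have := ble i (h t) ht; rewrite /dom /b; lra.
have defectE i : (\int[mu]_t (U i t)%:E)%E =
    (weight_pairing (rho (k i)) (B (k i)) - F (k i) (y_ (k i)))%:E.
  exact: (density_defect (rhoP (k i)) (@G_le (k i)) (dy (k i)) (Gy (k i))).
have Ucvg : weight_pairing (rho (k i)) (B (k i)) - F (k i) (y_ (k i))
    @[i --> \oo] --> (0 : R).
  have [| |_ _] := @dominated_convergence _ _ _ mu setT measurableT
    (fun i t => (U i t)%:E) (cst 0%E) (EFin \o dom)
    (fun i => (measurable_EFinP _ _).2 (mU i)) (measurable_cst _) _ idom.
  - apply: filterS pointwise => t [Ut _] _.
    by apply: cvg_EFin Ut; exact: nearW.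
  - apply: filterS pointwise => t [_ Ut] i _.
    by rewrite /= lee_fin ger0_norm ?normr_ge0.
  rewrite integral0 => /fine_cvgP[_]; apply: cvg_trans; apply: near_eq_cvg.
  by apply: nearW => i; rewrite /= defectE.
have [Acvg Bcvg] := MLUR_kbnorm_cvg x1 y1 x01 mid.
apply: (@cvg_dist_le _ _ _ (fun i => (1 - F (k i) (x_ (k i))) +
    (`|A (k i) - a| + `|B (k i) - a|) +
    (weight_pairing (rho (k i)) (B (k i)) - F (k i) (y_ (k i))))).
  apply: nearW => i.
  have := density_defect_ge0 (rhoP (k i)) (@G_le (k i)) (dx (k i)) (Gx (k i)).
  have := density_defect_ge0 (rhoP (k i)) (@G_le (k i)) (dy (k i)) (Gy (k i)).
  have := weight_pairing_le (rhoP (k i)) (A (k i)).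
  have := weight_pairing_le (rhoP (k i)) (B (k i)).
  have := weight_pairing_lip (rhoP (k i)) (A (k i)) (B (k i)).
  have := ler_normB (A (k i) - a) (B (k i) - a).
  rewrite (_ : A (k i) - a - (B (k i) - a) = A (k i) - B (k i)); last first.
    by rewrite opprB addrA subrK.
  rewrite -/(A (k i)) -/(B (k i)) /A /B !norm_kbnorm x1 y1 ler_norml.
  have := normr_ge0 (kbnorm (x_ (k i)) - a);
    have := normr_ge0 (kbnorm (y_ (k i)) - a).
  by move=> *; apply/andP; split; lra.
rewrite [X in _ --> X](_ : 0 = (1 - 1) + (0 + 0) + 0);
  last by rewrite subrr !addr0.
apply: cvgD => //; apply: cvgD; first by apply: cvgB;
  [exact: cvg_cst|exact: (cvg_subseq hk Fx)].
by apply: cvgD; [exact: (cvg_subseq hk Acvg)|exact: (cvg_subseq hk Bcvg)].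
Qed.

End convergence.

(** * Weights as functionals on the Koethe space *)

Section weight_functional.
Context {R : realType} d {T : measurableType d}.
Context {mu : {sigma_finite_measure set T -> \bar R}} (E : koetheSpace mu).
Local Notation kfun := (@koethe_fun R d T mu E).
Implicit Types (e : E) (rho : T -> R).

Definition weight_functional rho e := fine (\int[mu]_t (rho t * kfun e t)%:E)%E.

Section one_weight.
Variable rho : T -> R.
Hypothesis rhoP : koethe_weight E rho.

Let mrhoe e : measurable_fun setT (fun t => (rho t * kfun e t)%:E).
Proof.
case: rhoP => mrho _ _; apply/measurable_EFinP; apply: measurable_funM => //.
exact: measurable_koethe_fun.
Qed.

Lemma weight_functional_integrable e :
  mu.-integrable setT (fun t => (rho t * kfun e t)%:E).
Proof.
apply: le_integrable (weight_integrable rhoP e) => // t _.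
by rewrite /= lee_fin !normrM normr_id.
Qed.

Lemma weight_functionalE e :
  (\int[mu]_t (rho t * kfun e t)%:E)%E = (weight_functional rho e)%:E.
Proof. by rewrite fineK//; apply: integrable_fin_num => //;
  exact: weight_functional_integrable. Qed.

Lemma weight_functional_scalar : scalar (weight_functional rho).
Proof.
move=> b e f; apply: EFin_inj; rewrite EFinD EFinM -!weight_functionalE.
rewrite -integralZl//; last exact: weight_functional_integrable.
rewrite -integralD//; last 2 first.
- by apply: integrableZl => //; exact: weight_functional_integrable.
- exact: weight_functional_integrable.
apply: ae_eq_integral => //.
- apply: emeasurable_funD => //; apply: measurable_funeM; exact: mrhoe.
- apply: filterS2 (koethe_funDE (b *: e) f) (koethe_funZE b e) => t -> -> _.
  by rewrite -EFinM -EFinD mulrDr mulrCA.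
Qed.

Lemma weight_functional_le e : `|weight_functional rho e| <= `|e|.
Proof.
apply: le_trans (weight_pairing_le rhoP e); rewrite -lee_fin -weight_pairingE//.
rewrite -[leLHS]/(`|(weight_functional rho e)%:E|%E) -weight_functionalE.
apply: le_trans (le_abse_integral _ _ _) _ => //.
case: (rhoP) => _ rho0 _; rewrite le_eqVlt; apply/orP; left; apply/eqP.
by apply: eq_integral => t _; rewrite /= normrM ger0_norm.
Qed.

Lemma weight_functional_ge0 e : (\forall t \ae mu, 0 <= kfun e t) ->
  weight_functional rho e = weight_pairing rho e.
Proof.
move=> e0; apply: EFin_inj; rewrite -weight_functionalE -weight_pairingE//.
apply: ae_eq_integral => //;
  first by have /measurable_int := weight_integrable rhoP e.
by apply: filterS e0 => t et _; rewrite ger0_norm.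
Qed.

Lemma weight_functional_dual : dual E (weight_functional rho).
Proof.
apply: (@scalar_bounded_dual _ _ _ 1); first exact: weight_functional_scalar.
by move=> e; rewrite mul1r; exact: weight_functional_le.
Qed.

Lemma weight_functional_norm_le1 : dual_norm (weight_functional rho) <= 1.
Proof.
by apply: dual_norm_bounded => // e; rewrite mul1r; exact: weight_functional_le.
Qed.

End one_weight.

(** The integral is the difference of the two functionals at the element [e]
    that is [a] with the sign of [rho - sigma]. *)
Lemma weight_dist_le (rho sigma : T -> R) (L : E -> R) a :
  koethe_weight E rho -> koethe_weight E sigma -> dual E L ->
  (\forall t \ae mu, 0 <= kfun a t) ->
  (\int[mu]_t (`|rho t - sigma t| * `|kfun a t|)%:E <=
   ((dual_norm (weight_functional rho \- L) +
     dual_norm (weight_functional sigma \- L)) * `|a|)%:E)%E.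
Proof.
move=> rhoP sigmaP dL a0.
have [mrho rho0 _] := rhoP; have [msigma sigma0 _] := sigmaP.
pose P := [set t | sigma t <= rho t].
have mP : measurable P.
  by rewrite /P -[X in measurable X]setTI; exact: measurable_fun_le.
pose e := koethe_restr P a - koethe_restr (~` P) a.
have eE : \forall t \ae mu, kfun e t = (if t \in P then 1 else - 1) * kfun a t.
  apply: filterS3 (koethe_restrE a mP) (koethe_restrE a (measurableC mP))
    (koethe_funBE (koethe_restr P a) (koethe_restr (~` P) a)) => t h1 h2 ->.
  rewrite h1 h2 -mulrBl !indicE in_setC; case: (t \in P) => /=.
    by rewrite subr0.
  by rewrite sub0r.
have ea : `|e| <= `|a|.
  apply: koethe_le; apply: filterS eE => t ->; rewrite normrM.
  by case: (t \in P); rewrite ?normrN normr1 mul1r.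
have dB (tau : T -> R) : koethe_weight E tau ->
  dual E (weight_functional tau \- L).
  move=> tauP; have [lt _] := weight_functional_dual tauP; have [lL _] := dL.
  apply: (@scalar_bounded_dual _ _ _ (1 + dual_norm L)) => [b u v|u].
    by rewrite /= lt lL mulrBr; ring.
  rewrite mulrDl mul1r; apply: le_trans (ler_normB _ _) _; apply: lerD.
    exact: weight_functional_le.
  exact: dual_norm_le.
have -> : (\int[mu]_t (`|rho t - sigma t| * `|kfun a t|)%:E)%E =
    (weight_functional rho e - weight_functional sigma e)%:E.
  rewrite EFinB -!weight_functionalE// -integralB//; last 2 first.
  - exact: weight_functional_integrable.
  - exact: weight_functional_integrable.
  have mint := measurable_koethe_fun e.
  apply: ae_eq_integral => //.
  - apply/measurable_EFinP/measurable_weight; apply: measurableT_comp => //.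
    exact: measurable_funB.
  - by apply: emeasurable_funB; apply/measurable_EFinP; exact: measurable_funM.
  apply: filterS2 eE a0 => t -> at0 _; rewrite -EFinB (ger0_norm at0) -mulrBl.
  rewrite mulrA; congr (_ * _)%:E;
    have [/set_mem Pt|/negP nPt] := boolP (t \in P).
    by rewrite mulr1 ger0_norm// subr_ge0.
  rewrite mulrN1 ltr0_norm// subr_lt0 ltNge; apply/negP => Pt.
  by apply: nPt; exact: mem_set.
rewrite lee_fin (_ : _ - _ = (weight_functional rho \- L) e -
  (weight_functional sigma \- L) e); last by rewrite /=; ring.
apply: le_trans (ler_norm _) _; apply: le_trans (ler_normB _ _) _.
rewrite mulrDl; apply: lerD.
  apply: le_trans (dual_norm_le e (dB _ rhoP)) _.
  by rewrite ler_wpM2l// dual_norm_ge0//; exact: dB.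
apply: le_trans (dual_norm_le e (dB _ sigmaP)) _.
by rewrite ler_wpM2l// dual_norm_ge0//; exact: dB.
Qed.

(** A weak* limit [L'] of the weights satisfies [L' a = 1], so that it has norm
    one and the norms of the weights converge to its norm.  The Kadets-Klee*
    property then gives convergence in norm, which [weight_dist_le] turns into
    the Cauchy condition. *)
Lemma weights_cauchy (rho : nat -> T -> R) a :
  dual_kadets_klee_star E -> dual_ball_weak_star_seq_compact E ->
  (forall n, koethe_weight E (rho n)) -> `|a| = 1 ->
  (\forall t \ae mu, 0 <= kfun a t) ->
  weight_pairing (rho n) a @[n --> \oo] --> (1 : R) ->
  exists2 phi : nat -> nat, {homo phi : m n / (m < n)%N} &
    forall c : R, 0 < c -> exists N, forall n m, (N <= n)%N -> (n <= m)%N ->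
      (\int[mu]_t (`|rho (phi m) t - rho (phi n) t| * `|kfun a t|)%:E <=
        c%:E)%E.
Proof.
move=> KK cpt rhoP a1 a0 rhoa.
pose L n := weight_functional (rho n).
have [n|phi [L' [hphi [dL' L'1] LL']]] := cpt L.
  by split; [exact: weight_functional_dual|exact: weight_functional_norm_le1].
exists phi => //.
have La : L (phi n) a @[n --> \oo] --> (1 : R).
  apply: (cvg_subseq (u := fun n => L n a) hphi).
  by under eq_fun do rewrite /L weight_functional_ge0//.
have L'a : L' a = 1.
  by rewrite -(cvg_lim _ (LL' a))//; apply/cvg_lim.
have L'norm : dual_norm L' = 1.
  apply/eqP; rewrite eq_le L'1 /= -L'a -[leRHS]mulr1 -a1.
  by apply: le_trans (ler_norm _) _; exact: dual_norm_le.
have Lnorm : dual_norm (L (phi n)) @[n --> \oo] --> dual_norm L'.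
  rewrite L'norm; apply: (squeeze_cvgr _ La (_ : (fun=> 1) @ \oo --> (1 : R)));
    last exact: cvg_cst.
  apply: nearW => n.
  rewrite weight_functional_norm_le1// andbT -[leRHS]mulr1 -a1.
  apply: le_trans (ler_norm _) _; apply: dual_norm_le.
  exact: weight_functional_dual.
have := KK (L \o phi) L' (fun n =>
  weight_functional_dual (rhoP (phi n))) dL' LL' Lnorm.
move=> /cvgrPdistC_le h c c0.
have [N _ NP] := h (c / 2) ltac:(lra).
exists N => n m Nn nm;
  apply: le_trans (weight_dist_le (rhoP _) (rhoP _) dL' a0) _.
rewrite a1 mulr1 lee_fin.
have := NP n Nn; have := NP m (leq_trans Nn nm); rewrite /= !subr0.
by move=> /(le_trans (ler_norm _)) + /(le_trans (ler_norm _)); rewrite /L /=;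
  lra.
Qed.

End weight_functional.

Section koethe_bochner_alternative.
Context {R : realType} d {T : measurableType d}.
Context {mu : {sigma_finite_measure set T -> \bar R}} (E : koetheSpace mu).
Context (X : normedModType R).
Hypothesis E_MLUR : MLUR E.
Local Notation KB := (koetheBochner E X).

Lemma dual_sphere_le (F : KB -> R) : dual_sphere KB F -> forall z,
  `|F z| <= `|z|.
Proof. by move=> [dF F1] z; have := dual_norm_le z dF; rewrite F1 mul1r. Qed.

Lemma koethe_bochner_mluacs : mluacs X -> mluacs KB.
Proof.
move=> /mluacs_alternative altX x_ y_ x F x1 y1 x01 FS mid Fx.
pose z i := if odd i then y_ i./2 else x_ i./2.
have [rho [phi [G [rhoP dz GP Gz]]]] := functional_disintegration E_MLUR z
  FS.1.1 (dual_sphere_le FS).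
have zx n : z n.*2 = x_ n by rewrite /z odd_double doubleK.
have zy n : z n.*2.+1 = y_ n by rewrite /z /= odd_double /= uphalf_double.
apply: cvg_sub_subseq => k hk.
apply: (@convergence_along_subseq _ _ _ _ _ _ E_MLUR (@constant_seq _ _) _ _
  altX
  (fun n => x_ (k n)) (fun n => y_ (k n)) x
  (fun n => x1 (k n)) (fun n => y1 (k n)) x01 _ (fun=> F) (fun=> rho)
  (fun=> G) (fun n => phi (k n).*2) (fun n => phi (k n).*2.+1)) => //.
- by move=> s f_ fc n; rewrite (fc n).
- by move=> s f_ fc n; rewrite fc [RHS]fc.
- exact: (cvg_subseq hk mid).
- by move=> n t; case: (GP t).
- by move=> n t; case: (GP t).
- by move=> n; rewrite -zx; exact: dz.
- by move=> n; rewrite -zy; exact: dz.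
- by move=> n; apply: filterS Gz => t Gz; rewrite -zx Gz.
- by move=> n; apply: filterS Gz => t Gz; rewrite -zy Gz.
- move=> c c0; exists 0%N => n m _ _.
  under eq_integral do rewrite subrr normr0 mul0r.
  by rewrite integral0 lee_fin ltW.
- exact: (cvg_subseq hk Fx).
Qed.

Lemma koethe_bochner_msluacs : msluacs X -> dual_kadets_klee_star E ->
  dual_ball_weak_star_seq_compact E -> msluacs KB.
Proof.
move=> /msluacs_alternative altX KK cpt x_ y_ x F x1 y1 x01 FS mid Fx.
pose z n i := if i is 0%N then x_ n else y_ n.
have h n : exists D : (T -> R) * (nat -> T -> R) * (T -> X -> R),
  [/\ koethe_weight E D.1.1, forall i, density (F n) (z n i) (D.1.2 i),
      forall t, scalar (D.2 t) /\ (forall v, `|D.2 t v| <= D.1.1 t * `|v|) &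
      \forall t \ae mu, forall i, D.2 t (kbfun (z n i) t) = D.1.2 i t].
  have [rho [phi [G H]]] := functional_disintegration E_MLUR (z n)
    (FS n).1.1 (dual_sphere_le (FS n)).
  by exists (rho, phi, G).
have [D DP] := choice h.
pose rho n := (D n).1.1; pose phi n := (D n).1.2; pose G n := (D n).2.
have rhoP n : koethe_weight E (rho n) by case: (DP n).
have dz n i : density (F n) (z n i) (phi n i) by case: (DP n).
have Gl n t : scalar (G n t) by case: (DP n) => _ _ /(_ t)[].
have Gle n t v : `|G n t v| <= rho n t * `|v|.
  by case: (DP n) => _ _ /(_ t)[_ +] _; exact.
have Gz n i : \forall t \ae mu, G n t (kbfun (z n i) t) = phi n i t.
  by case: (DP n) => _ _ _; apply: filterS => t; exact.
have [Acvg _] := MLUR_kbnorm_cvg E_MLUR x1 y1 x01 mid.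
have rhoa : weight_pairing (rho n) (kbnorm x) @[n --> \oo] --> (1 : R).
  have low : F n (x_ n) - `|kbnorm (x_ n) - kbnorm x| @[n --> \oo] --> (1 : R).
    by rewrite -[X in _ --> X]subr0; exact: cvgB.
  apply: (squeeze_cvgr _ low (_ : (fun=> 1) @ \oo --> (1 : R)));
    last exact: cvg_cst.
  apply: nearW => n.
  have := weight_pairing_le (rhoP n) (kbnorm x); rewrite norm_kbnorm x01 => ->.
  have := density_defect_ge0 (rhoP n) (Gle n) (dz n 0%N) (Gz n 0%N).
  have := weight_pairing_lip (rhoP n) (kbnorm (x_ n)) (kbnorm x).
  by rewrite /z andbT; lra.
apply: cvg_sub_subseq => k hk.
have [|||j hj rho_cauchy] :=
  @weights_cauchy _ _ _ _ _ (rho \o k) (kbnorm x) KK cpt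
  (fun n => rhoP (k n)).
- by rewrite norm_kbnorm.
- exact: kbnorm_ge0.
- exact: (cvg_subseq hk rhoa).
have hkj : {homo k \o j : m n / (m < n)%N} by move=> m n /hj /hk.
suff [i hi Fy] : exists2 i : nat -> nat, {homo i : m n / (m < n)%N} &
    F (k (j (i n))) (y_ (k (j (i n)))) @[n --> \oo] --> (1 : R).
  by exists (j \o i) => // m n /hi /hj.
apply: (@convergence_along_subseq _ _ _ _ _ _ E_MLUR
  setT _ _ altX (fun n => x_ (k (j n))) (fun n => y_ (k (j n))) x
  (fun n => x1 (k (j n))) (fun n => y1 (k (j n))) x01 _
  (fun n => F (k (j n))) (fun n => rho (k (j n))) (fun n => G (k (j n)))
  (fun n => phi (k (j n)) 0%N) (fun n => phi (k (j n)) 1%N)) => //.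
- exact: (cvg_subseq hkj mid).
- by move=> n; exact: (dz _ 0%N).
- by move=> n; exact: (dz _ 1%N).
- by move=> n; exact: (Gz _ 0%N).
- by move=> n; exact: (Gz _ 1%N).
- exact: (cvg_subseq hkj Fx).
Qed.

End koethe_bochner_alternative.

Theorem theorem3p15 (R : realType) (d : measure_display) (T : measurableType d)
    (mu : {sigma_finite_measure set T -> \bar R})
    (mu_complete : measure_is_complete mu)
    (E : koetheSpace mu) (X : completeNormedModType R)
    (E_MLUR : MLUR E) :
  (mluacs X -> mluacs (koetheBochner E X)) /\
  (msluacs X -> dual_kadets_klee_star E -> dual_ball_weak_star_seq_compact E ->
   msluacs (koetheBochner E X)).
Proof.
by split; [exact: koethe_bochner_mluacs|exact: koethe_bochner_msluacs].
Qed.
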